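(* Let $\mathbf{k}$ be a field of characteristic zero, $P=(x\partial_x-r_1)\cdots(x\partial_x-r_k)$ with $r_1,\dots,r_k\in\mathbf{k}$, and $Q=\sum_{i\ge1}Q_it^i$ with $Q_i\in\mathbf{k}(\!(x)\!)[\partial_x]$. Let $s_1,\dots,s_l$ and $k_1,\dots,k_l$ be as defined in the context, and put $V_i=x^{s_i}\mathbf{k}(\!(x)\!)[\log x][[t]]$, $i=1,\dots,l$. For $r\in\mathbf{k}$ consider the equation $$(P+Q)f=0,\qquad f\in x^r\mathbf{k}(\!(x)\!)[\log x][[t]].\tag{$*$}$$ Then: 1. The space of solutions of $( * )$ is nonzero if and only if $r-s_i\in\mathbb{Z}$ for some $i\in\{1,\dots,l\}$; in this case, without loss of generality, one can set $r=s_i$, and therefore $f\in V_i$. 2. For each $i$, the space of solutions of $( * )$ with $f\in V_i$ is a free $k_i$-dimensional module over $\mathbf{k}[[t]]$. 3. Moreover, this module, after an extension of scalars, has a basis $f_{i,1},\dots,f_{i,k_i}$ such that $$f_{i,j}=x^{s_i+\lambda_{i,j}}g_{i,j}\in x^{s_i+\lambda_{i,j}}\,\bar{\mathbf{k}}(\!(x)\!)[[t^{1/L}]][\log x],\qquad \lambda_{i,j}\in t^{1/L}\cdot\bar{\mathbf{k}}[[t^{1/L}]],$$ for some $L\ge1$, where the degrees of the elements $g_{i,j}\in\bar{\mathbf{k}}(\!(x)\!)[[t^{1/L}]][\log x]$ as polynomials in $\log x$ are smaller than $k_i$.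
   Context: $\bar{\mathbf{k}}$ is an algebraic closure of $\mathbf{k}$, and $t$ is a formal parameter. Each $Q_i$ has the form $\sum_{j\ge -N_i}\sum_{m=0}^{M_i}q_{i,j,m}x^j\partial_x^m$ with $q_{i,j,m}\in\mathbf{k}$; $N_i,M_i$ need not be bounded and can increase with $i$. Say $r_i\sim r_j$ iff $r_i-r_j\in\mathbb{Z}$. Let $s_1,\dots,s_l$ be the smallest representatives of the equivalence classes of $\{r_1,\dots,r_k\}$: $s_i-s_j\notin\mathbb{Z}$ for $i\ne j$, each $s_i$ is one of the $r$'s, and every $r_i$ is $s_j+m$ for some $j$ and some integer $m\ge0$. Write $P=\prod_{i=1}^l\prod_{j\ge0}(x\partial_x-s_i-j)^{a_{i,j}}$ with $a_{i,j}\ge0$, and $k_i=\sum_{j\ge0}a_{i,j}$, so $k_1+\dots+k_l=k$. Here $x^r$ and $\log x$ are formal symbols with the usual differentiation rules $\partial_xx^r=rx^{r-1}$, $\partial_x\log x=x^{-1}$, and $x^{r+m}=x^rx^m$ for $m\in\mathbb{Z}$. The expression $x^{s_i+\lambda_{i,j}}$ is understood as $$x^{s_i+\lambda_{i,j}}=x^{s_i}e^{\lambda_{i,j}\log x}=x^{s_i}\sum_{m\ge0}\frac{\lambda_{i,j}^m(\log x)^m}{m!}\in x^{s_i}\bar{\mathbf{k}}(\!(x)\!)[\log x][[t^{1/L}]].$$ The order of iterated ring constructions matters: in $\bar{\mathbf{k}}(\!(x)\!)[[t^{1/L}]][\log x]$ elements are polynomials in $\log x$, whereas in $\bar{\mathbf{k}}(\!(x)\!)[\log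 x][[t^{1/L}]]$ the degree in $\log x$ may grow with the power of $t^{1/L}$. *)

(* Defs.v *)
From HB Require Import structures.
From mathcomp Require Import all_boot all_order all_algebra.
From mathcomp Require Import boolp zify.
Set Implicit Arguments.
Unset Strict Implicit.
Unset Printing Implicit Defensive.
Import Order.TTheory GRing.Theory Num.Theory.
Local Open Scope ring_scope.

(* R[[t]]: [f n] is the coefficient of t^n. *)
Record fps (R : Type) := Fps { fps_coef :> nat -> R }.

(* R((x)): [f j] is the coefficient of x^j. *)
Record laurent (R : nmodType) := Laurent {
  laurent_coef :> int -> R;
  laurent_bounded : exists N : int, forall j, j < N -> laurent_coef j = 0
}.

Section PowerSeries.
Variable R : comNzRingType.
Implicit Types f g h : fps R.

HB.instance Definition _ := gen_eqMixin (fps R).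
HB.instance Definition _ := gen_choiceMixin (fps R).

Lemma fpsP f g : (forall n, f n = g n) -> f = g.
Proof. by case: f g => [f] [g] /= /funext ->. Qed.

Definition fps_zero := Fps (fun=> 0 : R).
Definition fps_opp f := Fps (fun n => - f n).
Definition fps_add f g := Fps (fun n => f n + g n).
Definition fps_one := Fps (fun n => (n == 0)%N%:R : R).
Definition fps_mul f g := Fps (fun n => \sum_(i < n.+1) f i * g (n - i)%N).

Fact fps_addA : associative fps_add.
Proof. by move=> f g h; apply: fpsP => n /=; rewrite addrA. Qed.
Fact fps_addC : commutative fps_add.
Proof. by move=> f g; apply: fpsP => n /=; rewrite addrC. Qed.
Fact fps_add0 : left_id fps_zero fps_add.
Proof. by move=> f; apply: fpsP => n /=; rewrite add0r. Qed.
Fact fps_addN : left_inverse fps_zero fps_opp fps_add.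
Proof. by move=> f; apply: fpsP => n /=; rewrite addNr. Qed.

HB.instance Definition _ :=
  GRing.isZmodule.Build (fps R) fps_addA fps_addC fps_add0 fps_addN.

Fact fps_mulC : commutative fps_mul.
Proof.
move=> f g; apply: fpsP => n /=; rewrite (reindex_inj rev_ord_inj) /=.
by apply: eq_bigr => i _; rewrite subSS subKn ?leq_ord // mulrC.
Qed.

Fact fps_mulA : associative fps_mul.
Proof.
move=> p q r; apply: fpsP => i /=.
rewrite [RHS](reindex_inj rev_ord_inj) /=.
under [RHS]eq_bigr => j _ do rewrite subSS (subKn (leq_ord j)).
pose coef3 j k := p j * (q (i - j - k)%N * r k).
transitivity (\sum_(j < i.+1) \sum_(k < i.+1 | (k <= i - j)%N) coef3 j k).
  apply: eq_bigr => /= j _.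
  rewrite (reindex_inj rev_ord_inj) /= big_distrr /=.
  rewrite (big_ord_narrow_leq (leq_subr _ _)); apply: eq_bigr => k _.
  by rewrite /coef3 subSS /= (subKn (leq_ord k)).
rewrite (exchange_big_dep predT) //=; apply: eq_bigr => k _.
transitivity (\sum_(j < i.+1 | (j <= i - k)%N) coef3 j k).
  apply: eq_bigl => j; rewrite -ltnS -(ltnS j) -!subSn ?leq_ord //.
  by rewrite -subn_gt0 -(subn_gt0 j) -!subnDA addnC.
rewrite (big_ord_narrow_leq (leq_subr _ _)) big_distrl /=.
by apply: eq_bigr => j _; rewrite /coef3 -!subnDA addnC mulrA.
Qed.

Fact fps_mul1 : left_id fps_one fps_mul.
Proof.
move=> f; apply: fpsP => n /=.
rewrite big_ord_recl /= mul1r subn0 big1 ?addr0 // => i _.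
by rewrite /= mul0r.
Qed.

Fact fps_mulDl : left_distributive fps_mul fps_add.
Proof.
move=> f g h; apply: fpsP => n /=; rewrite -big_split /=.
by apply: eq_bigr => i _; rewrite mulrDl.
Qed.

Fact fps_one_neq0 : fps_one != 0.
Proof.
apply/eqP => /(congr1 (fun f : fps R => f 0%N)) /= /eqP.
by rewrite oner_eq0.
Qed.

HB.instance Definition _ := GRing.Zmodule_isComNzRing.Build (fps R)
  fps_mulA fps_mulC fps_mul1 fps_mulDl fps_one_neq0.

End PowerSeries.

Section LaurentSeries.
Variable R : comNzRingType.
Implicit Types (f g h : laurent R) (F G : fps R) (N M : int).

HB.instance Definition _ := gen_eqMixin (laurent R).
HB.instance Definition _ := gen_choiceMixin (laurent R).

Lemma laurentP f g : (forall n, f n = g n) -> f = g.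
Proof.
case: f g => [f Bf] [g Bg] /= /funext fg.
by case: g / fg Bg => Bg; rewrite (Prop_irrelevance Bf Bg).
Qed.

(* x^N F as a Laurent series *)
Fact laurent_of_fps_bounded N F :
  exists M, forall j, j < M -> (if N <= j then F `|j - N|%N else 0) = 0.
Proof. by exists N => j ltjN; rewrite leNgt ltjN. Qed.

Definition laurent_of_fps N F := Laurent (laurent_of_fps_bounded N F).

Definition bounded_at N f := forall j, j < N -> f j = 0.

Definition lbound f : int := projT1 (cid (laurent_bounded f)).

Lemma lboundP f : bounded_at (lbound f) f.
Proof. exact: projT2 (cid (laurent_bounded f)). Qed.

(* x^{-N} f, when f is bounded at N *)
Definition fps_of_laurent N f := Fps (fun i : nat => f (N + i%:Z)).

Lemma fps_of_laurentK N f :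
  bounded_at N f -> laurent_of_fps N (fps_of_laurent N f) = f.
Proof.
move=> Nf; apply: laurentP => j /=; case: leP => [leNj|/Nf->//].
by congr (f _); lia.
Qed.

Lemma laurent_of_fpsK N F : fps_of_laurent N (laurent_of_fps N F) = F.
Proof.
apply: fpsP => n /=; rewrite lerDl /=.
by have -> : `|(N + n%:Z - N)%R|%N = n by lia.
Qed.

Lemma laurent_of_fps_bound N F : bounded_at N (laurent_of_fps N F).
Proof. by move=> j ltjN /=; rewrite leNgt ltjN. Qed.

Lemma bounded_atW N M f : N <= M -> bounded_at M f -> bounded_at N f.
Proof. by move=> leNM Mf j ltjN; apply/Mf/(lt_le_trans ltjN). Qed.

Fact laurent_zero_bounded : exists N, forall j, j < N -> (0 : R) = 0.
Proof. by exists 0. Qed.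
Definition laurent_zero := Laurent laurent_zero_bounded.

Fact laurent_opp_bounded f : exists N, forall j, j < N -> - f j = 0.
Proof. by exists (lbound f) => j /lboundP ->; rewrite oppr0. Qed.
Definition laurent_opp f := Laurent (laurent_opp_bounded f).

Fact laurent_add_bounded f g : exists N, forall j, j < N -> f j + g j = 0.
Proof.
exists (Order.min (lbound f) (lbound g)) => j.
by rewrite lt_min => /andP[/lboundP-> /lboundP->]; rewrite addr0.
Qed.
Definition laurent_add f g := Laurent (laurent_add_bounded f g).

Fact laurent_addA : associative laurent_add.
Proof. by move=> f g h; apply: laurentP => n /=; rewrite addrA. Qed.
Fact laurent_addC : commutative laurent_add.
Proof. by move=> f g; apply: laurentP => n /=; rewrite addrC. Qed.
Fact laurent_add0 : left_id laurent_zero laurent_add.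
Proof. by move=> f; apply: laurentP => n /=; rewrite add0r. Qed.
Fact laurent_addN : left_inverse laurent_zero laurent_opp laurent_add.
Proof. by move=> f; apply: laurentP => n /=; rewrite addNr. Qed.

HB.instance Definition _ := GRing.isZmodule.Build (laurent R)
  laurent_addA laurent_addC laurent_add0 laurent_addN.

(* (x^N F) (x^M G) = x^(N+M) (F G); the choice of the bounds is irrelevant,
   see laurent_mulE and coef_laurent_mul *)
Definition laurent_mul f g :=
  laurent_of_fps (lbound f + lbound g)
    (fps_of_laurent (lbound f) f * fps_of_laurent (lbound g) g).

Definition laurent_one := laurent_of_fps 0 1.

Lemma laurent_mulW N M N' M' f g :
    N' <= N -> M' <= M -> bounded_at N f -> bounded_at M g ->
  laurent_of_fps (N + M) (fps_of_laurent N f * fps_of_laurent M g) =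
  laurent_of_fps (N' + M') (fps_of_laurent N' f * fps_of_laurent M' g).
Proof.
move=> leN leM Nf Mg; apply: laurentP => j.
rewrite /laurent_of_fps /= -!/(fps_mul _ _).
set S := (X in _ = if _ then X else _).
have [d dE] : exists d : nat, N = N' + d%:Z by exists `|(N - N')%R|%N; lia.
have [e eE] : exists e : nat, M = M' + e%:Z by exists `|(M - M')%R|%N; lia.
case: (leP (N' + M') j) => [le'|lt']; last by rewrite ifF //; lia.
have [n nE] : exists n : nat, j = N' + M' + n%:Z.
  by exists `|(j - (N' + M'))%R|%N; lia.
have SE : S = \sum_(i < n.+1) f (N' + i%:Z) * g (M' + (n - i)%N%:Z).
  by rewrite /S; have -> : `|(j - (N' + M'))%R|%N = n by lia.
rewrite {S}SE.
case: leP => [le1|lt1]; last first.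
  rewrite big1 // => i _; have [lti|lei] := ltP (N' + i%:Z) N.
    by rewrite Nf ?mul0r.
  by rewrite [g _]Mg ?mulr0 //; have := ltn_ord i; lia.
have [m mE] : exists m : nat, n = (d + m + e)%N by exists (n - d - e)%N; lia.
have -> : `|(j - (N + M))%R|%N = m by lia.
rewrite mE -!addnS -addnA [RHS]big_split_ord /= [X in _ = X + _]big1 ?add0r;
  last first.
  by move=> i _; rewrite Nf ?mul0r //; have := ltn_ord i; lia.
rewrite -addSnnS [RHS]big_split_ord /= [X in _ = _ + X]big1 ?addr0; last first.
  by move=> i _; rewrite [g _]Mg ?mulr0 //; have := ltn_ord i; rewrite /=; lia.
apply: eq_bigr => i _; have := ltn_ord i => ltim.
by congr (f _ * g _); lia.
Qed.

Lemma laurent_mulE N M f g : bounded_at N f -> bounded_at M g ->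
  laurent_mul f g =
  laurent_of_fps (N + M) (fps_of_laurent N f * fps_of_laurent M g).
Proof.
move=> Nf Mg; pose N' := Order.min N (lbound f).
pose M' := Order.min M (lbound g).
rewrite /laurent_mul (@laurent_mulW _ _ N' M') ?ge_min ?lexx ?orbT //;
  try exact: lboundP.
by apply/esym/laurent_mulW; rewrite ?ge_min ?lexx.
Qed.

Lemma coef_laurent_mul N M f g (n : nat) :
    bounded_at N f -> bounded_at M g ->
  laurent_mul f g (N + M + n%:Z) =
  \sum_(i < n.+1) f (N + i%:Z) * g (M + (n - i)%N%:Z).
Proof.
move=> Nf Mg; rewrite (laurent_mulE Nf Mg) /= lerDl /=.
by have -> : `|(N + M + n%:Z - (N + M))%R|%N = n by lia.
Qed.

Fact laurent_mulC : commutative laurent_mul.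
Proof. by move=> f g; rewrite /laurent_mul mulrC addrC. Qed.

Fact laurent_mulA : associative laurent_mul.
Proof.
move=> f g h; have Bf := @lboundP f; have Bg := @lboundP g.
have Bh := @lboundP h.
rewrite (laurent_mulE Bf (@laurent_of_fps_bound _ _)).
rewrite (laurent_mulE (@laurent_of_fps_bound _ _) Bh).
by rewrite !laurent_of_fpsK mulrA addrA.
Qed.

Fact laurent_mul1 : left_id laurent_one laurent_mul.
Proof.
move=> f; rewrite (laurent_mulE (@laurent_of_fps_bound _ _) (@lboundP f)).
by rewrite laurent_of_fpsK mul1r add0r fps_of_laurentK //; apply: lboundP.
Qed.

Fact laurent_mulDl : left_distributive laurent_mul laurent_add.
Proof.
move=> f g h; pose N := Order.min (lbound f) (lbound g).
have Nf : bounded_at N f.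
  by apply: (@bounded_atW _ (lbound f)) (@lboundP f); rewrite ge_min lexx.
have Ng : bounded_at N g.
  by apply: (@bounded_atW _ (lbound g)) (@lboundP g); rewrite ge_min lexx orbT.
have Nfg : bounded_at N (laurent_add f g).
  by move=> j ltj /=; rewrite Nf // Ng // addr0.
have Bh := @lboundP h.
rewrite (laurent_mulE Nf Bh) (laurent_mulE Ng Bh) (laurent_mulE Nfg Bh).
have -> : fps_of_laurent N (laurent_add f g) =
          fps_of_laurent N f + fps_of_laurent N g by apply: fpsP.
rewrite mulrDl; apply: laurentP => j /=.
by case: ifP => _ //; rewrite addr0.
Qed.

Fact laurent_one_neq0 : laurent_one != 0.
Proof.
apply/eqP => /(congr1 (fun f : laurent R => f 0)) /= /eqP.
by rewrite oner_eq0.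
Qed.

HB.instance Definition _ := GRing.Zmodule_isComNzRing.Build (laurent R)
  laurent_mulA laurent_mulC laurent_mul1 laurent_mulDl laurent_one_neq0.

(* c x^j *)
Fact lmon_bounded (c : R) (j : int) :
  exists N, forall i, i < N -> (if i == j then c else 0) = 0.
Proof. by exists j => i; rewrite lt_neqAle => /andP[/negPf->]. Qed.
Definition lmon (c : R) (j : int) := Laurent (lmon_bounded c j).

Definition lconst (c : R) := lmon c 0.

Fact lconst_is_zmod_morphism : zmod_morphism lconst.
Proof.
move=> c d; apply: laurentP => j /=.
by case: eqP => _ //; rewrite subr0.
Qed.
HB.instance Definition _ :=
  GRing.isZmodMorphism.Build R (laurent R) lconst lconst_is_zmod_morphism.

Fact lderiv_bounded f :
  exists N, forall j, j < N -> (j + 1)%:~R * f (j + 1) = 0.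
Proof.
by exists (lbound f - 1) => j ltj; rewrite (@lboundP f) ?mulr0 //; lia.
Qed.
Definition lderiv f := Laurent (lderiv_bounded f).

(* The inclusion of R[[t]] in R((t)) *)
Definition laurent_fps F := laurent_of_fps 0 F.

End LaurentSeries.

Section Functoriality.
Variables R S : comNzRingType.

Definition fps_map (h : R -> S) (f : fps R) := Fps (fun n => h (f n)).

Fact laurent_map_bounded (h : {additive R -> S}) (f : laurent R) :
  exists N, forall j, j < N -> h (f j) = 0.
Proof. by exists (lbound f) => j /lboundP ->; rewrite raddf0. Qed.
Definition laurent_map (h : {additive R -> S}) (f : laurent R) :=
  Laurent (laurent_map_bounded h f).

End Functoriality.

(* The substitution t := u^L, with u the variable of the result. *)
Definition ramify (R : comNzRingType) (L : nat) (f : fps R) : fps R :=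
  Fps (fun n => if (L %| n)%N then f (n %/ L)%N else 0).

(* K((x))[log x]; the polynomial variable is log x. *)
Notation logpoly K := {poly (laurent K)}.
(* K((x))[log x][[t]] *)
Notation logser K := (fps (logpoly K)).

(* An element x^r p of x^r K((x))[log x] (resp. x^r f of
   x^r K((x))[log x][[t]]) is represented by the cofactor p (resp. f), and
   operators act on cofactors: x^r (dx r p) is the derivative of x^r p. *)
Section Operators.
Variable K : comNzRingType.

Definition dx (r : K) (p : logpoly K) : logpoly K :=
  lmon r (-1) *: p + map_poly (@lderiv K) p + lmon 1 (-1) *: p^`().

(* x d/dx *)
Definition theta (r : K) (p : logpoly K) : logpoly K := lmon 1 1 *: dx r p.

(* The action of sum_m q_m D^m, where the coefficients q_m of q are written on
   the left of the powers of D. *)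
Definition op_act (D : logpoly K -> logpoly K) (q : {poly (laurent K)})
    (p : logpoly K) : logpoly K :=
  \sum_(m < size q) q`_m *: iter m D p.

(* The operator (P + Q) f on x^r K((x))[log x][[t]], with P in K[x d/dx] given
   as a polynomial in x d/dx, and Q = sum_(i >= 1) Q_i t^i where Q_i in
   K((x))[d/dx] is given as a polynomial in d/dx; Q 0 is not used. *)
Definition PQ (P : {poly K}) (Q : nat -> {poly (laurent K)}) (r : K)
    (f : logser K) : logser K :=
  Fps (fun n => op_act (theta r) (map_poly (@lconst K) P) (f n)
    + \sum_(1 <= i < n.+1) op_act (dx r) (Q i) (f (n - i)%N)).

(* x^r f is a solution of (P + Q)(x^r f) = 0. *)
Definition solution P Q (r : K) (f : logser K) : Prop := PQ P Q r f = 0.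

(* K[[t]] -> K((x))[log x][[t]] *)
Definition scalar_fps (c : fps K) : logser K :=
  fps_map (polyC \o @lconst K) c.

(* K((t)) -> K((x))[log x]((t)) *)
Definition scalar_laurent (c : laurent K) : laurent (logpoly K) :=
  laurent_map (polyC \o @lconst K) c.

(* multiplication by x^m *)
Definition mul_xn (m : int) (f : logser K) : logser K :=
  fps_map (fun p => lmon 1 m *: p) f.

(* The inclusion of K((x))[[t]][log x] in K((x))[log x][[t]]. *)
Definition log_in (g : {poly (fps (laurent K))}) : logser K :=
  Fps (fun n => \poly_(m < size g) (g`_m n)).

End Operators.

(* x^lam = sum_m lam^m (log x)^m / m!, for lam in t K[[t]]; only the terms with
   m <= n contribute to the coefficient of t^n, because lam^m is in t^m K[[t]]. *)
Definition xpow_fps (K : fieldType) (lam : fps K) : logser K :=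
  Fps (fun n => \poly_(m < n.+1) lconst ((lam ^+ m) n / (m`!)%:R)).

(* b is a basis of S as an A-module, where B is an A-module along phi : A -> B.
   The first clause also says that S is closed under A-linear combinations. *)
Definition is_basis (A B : comNzRingType) (phi : A -> B) (S : B -> Prop)
    (n : nat) (b : 'I_n -> B) : Prop :=
  (forall f, S f <-> exists c : 'I_n -> A, f = \sum_j phi (c j) * b j) /\
  (forall c : 'I_n -> A, \sum_j phi (c j) * b j = 0 -> forall j, c j = 0).

(* The A-submodule of B (along phi) spanned by the image of S by iota. *)
Definition span_image (A B B0 : comNzRingType) (phi : A -> B) (iota : B0 -> B)
    (S : B0 -> Prop) (h : B) : Prop :=
  exists (n : nat) (c : 'I_n -> A) (f : 'I_n -> B0),
    (forall j, S (f j)) /\ h = \sum_j phi (c j) * iota (f j).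

(* The embedding of K((x))[log x][[t]] in K'((x))[log x]((u)), with u = t^(1/L) *)
Definition puiseux_in (K K' : fieldType) (iota : {rmorphism K -> K'}) (L : nat)
    (f : logser K) : laurent (logpoly K') :=
  laurent_fps (ramify L (fps_map (map_poly (laurent_map iota)) f)).

(* Main.v *)
(* Write delta for d/d(log x). On x^(r+j) K[log x] the operator P(x d/dx) acts
   as P(r + j + delta), so it is onto, and its kernel on x^(s_i) K((x))[log x]
   consists of the combinations of x^(s_i+j) (log x)^q with q < a_{i,j}. Solving
   for the coefficients of t^n one after the other lifts this kernel basis to a
   K[[t]]-basis of the solutions of P + Q.
   The derivation delta commutes with P + Q, hence acts on this free module by
   a matrix A over K[[t]]. By the Newton-Puiseux theorem the characteristic
   polynomial of A splits over Kbar[[t^(1/L)]], so over Kbar((t^(1/L))) there is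
   a basis of generalized eigenvectors f_j of delta, with eigenvalues lam_j.
   Then delta^(k_i) kills x^(-lam_j) f_j, which is therefore a polynomial in
   log x of degree less than k_i. Finally lam_j vanishes at t = 0, because
   delta - c is injective on polynomials in log x for every constant c <> 0. *)
From HB Require Import structures.
Require Import Defs.
From mathcomp Require Import all_boot all_order all_algebra.
From mathcomp Require Import boolp zify ring.
Set Implicit Arguments.
Unset Strict Implicit.
Unset Printing Implicit Defensive.
Import Order.TTheory GRing.Theory Num.Theory.
Local Open Scope ring_scope.

(** * Power series and Laurent series *)

(** Generalized eigenvectors are found over the field Kbar((u)), u^L = t, whereas [dlog], x^lam and
    the argument that lam vanishes at u = 0 live on power series in u. Each eigenvector is therefore
    multiplied by a power of u that clears its denominators, which does not disturb a homogeneous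
    equation. The matrix of eigenvectors is then known to be invertible only over Kbar((u)), and
    this is why the final basis is one over Laurent series. The eigenvalues themselves have no
    poles, because the characteristic polynomial is monic. Linear independence survives the
    extension of scalars because the chosen solutions have monomials x^j (log x)^q as constant terms
    in t, and these are independent over any coefficient ring. *)

Lemma course_of_values (T : Type) (x0 : T) (F : nat -> (nat -> T) -> T) :
    (forall n f g, (forall i, (i < n)%N -> f i = g i) -> F n f = F n g) ->
  exists f, forall n, f n = F n f.
Proof.
move=> FE.
(* [s n] lists the first n values; [x0] only fills [nth] out of range, which [FE] makes
   invisible. *)
pose s := fix s n :=
  if n is m.+1 then rcons (s m) (F m (nth x0 (s m))) else [::].
have sz n : size (s n) = n by elim: n => //= n IH; rewrite size_rcons IH.
have sE n i : (i < n)%N -> nth x0 (s n) i = nth x0 (s i.+1) i.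
  elim: n => // n IH; rewrite ltnS leq_eqVlt => /predU1P[->//|ltin].
  by rewrite -IH //= nth_rcons sz ltin.
exists (fun n => nth x0 (s n.+1) n) => n /=.
by rewrite nth_rcons sz ltnn eqxx; apply: FE => i /sE.
Qed.

Lemma natr_neq0 (K : fieldType) (char0 : [pchar K] =i pred0) n :
  n.+1%:R != 0 :> K.
Proof. by rewrite ((pcharf0P K).1 char0). Qed.

Section FpsRing.
Variable R : comNzRingType.
Implicit Types f g : fps R.

Lemma coef_fps0 n : (0 : fps R) n = 0. Proof. by []. Qed.
Lemma coef_fps1 n : (1 : fps R) n = (n == 0)%N%:R. Proof. by []. Qed.
Lemma coef_fpsD f g n : (f + g) n = f n + g n. Proof. by []. Qed.
Lemma coef_fpsN f n : (- f) n = - f n. Proof. by []. Qed.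
Lemma coef_fpsM f g n : (f * g) n = \sum_(i < n.+1) f i * g (n - i)%N.
Proof. by []. Qed.

Lemma coef_fps_sum I (r : seq I) (P : pred I) (F : I -> fps R) n :
  (\sum_(i <- r | P i) F i) n = \sum_(i <- r | P i) F i n.
Proof.
by elim/big_rec2: _ => [|i y x _ <-]; rewrite ?coef_fps0 ?coef_fpsD.
Qed.

Lemma fps_neq0 f : f != 0 ->
  exists2 n, f n != 0 & forall i, (i < n)%N -> f i = 0.
Proof.
move=> fn0; have ex : exists n, f n != 0.
  have /existsNP[n /eqP fn] : ~ forall n, f n = 0.
    by move=> f0; case/eqP: fn0; apply: fpsP.
  by exists n.
exists (ex_minn ex); case: ex_minnP => n // fn min i ltin.
by apply: contraTeq ltin => /min; rewrite -leqNgt.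
Qed.

Definition fps_shift (d : nat) f : fps R := Fps (fun n => f (n + d)%N).

Definition fpsX (d : nat) : fps R := Fps (fun n => (n == d)%:R).

Lemma coef_fpsXM d f n :
  (fpsX d * f) n = if (d <= n)%N then f (n - d)%N else 0.
Proof.
rewrite coef_fpsM; case: leqP => [ledn|ltnd].
  have ltd : (d < n.+1)%N by [].
  rewrite (bigD1 (Ordinal ltd)) //= eqxx mul1r big1 ?addr0 // => i.
  by rewrite -val_eqE /= => /negPf->; rewrite mul0r.
rewrite big1 // => i _; rewrite /= (_ : _ == _ = false) ?mul0r //.
by have := ltn_ord i; lia.
Qed.

Lemma fps_shiftK d f :
  (forall i, (i < d)%N -> f i = 0) -> fpsX d * fps_shift d f = f.
Proof.
move=> f0; apply: fpsP => n; rewrite coef_fpsXM.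
by case: leqP => [le|/f0//]; rewrite /= subnK.
Qed.

Lemma fpsX0 : fpsX 0 = 1. Proof. exact: fpsP. Qed.

Lemma fpsXD m n : fpsX (m + n) = fpsX m * fpsX n.
Proof.
apply: fpsP => i; rewrite coef_fpsXM /=; case: leqP => [le|lt].
  by congr (_%:R); lia.
by rewrite (_ : _ == _ = false) //; lia.
Qed.

Definition fpsC (c : R) : fps R := Fps (fun n => if n == 0%N then c else 0).

End FpsRing.

Arguments fpsX {R} d.

Section FpsMorphism.
Variables (R S : comNzRingType) (h : {rmorphism R -> S}).

Fact fps_map_zmod_morphism : zmod_morphism (fps_map h).
Proof. by move=> f g; apply: fpsP => n /=; rewrite rmorphB. Qed.
HB.instance Definition _ := GRing.isZmodMorphism.Build
  (fps R) (fps S) (fps_map h) fps_map_zmod_morphism.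

Fact fps_map_monoid_morphism : monoid_morphism (fps_map h).
Proof.
split=> [|f g]; apply: fpsP => n /=; first by rewrite rmorph_nat.
by rewrite rmorph_sum; apply: eq_bigr => i _; rewrite rmorphM.
Qed.
HB.instance Definition _ := GRing.isMonoidMorphism.Build
  (fps R) (fps S) (fps_map h) fps_map_monoid_morphism.

Fact laurent_map_zmod_morphism : zmod_morphism (laurent_map h).
Proof. by move=> f g; apply: laurentP => n /=; rewrite rmorphB. Qed.
HB.instance Definition _ := GRing.isZmodMorphism.Build
  (laurent R) (laurent S) (laurent_map h) laurent_map_zmod_morphism.

Lemma bounded_laurent_map N f :
  bounded_at N f -> bounded_at N (laurent_map h f).
Proof. by move=> Nf j /Nf /= ->; rewrite rmorph0. Qed.

Lemma laurent_map_of_fps N F :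
  laurent_map h (laurent_of_fps N F) = laurent_of_fps N (fps_map h F).
Proof. by apply: laurentP => j /=; case: ifP => // _; rewrite rmorph0. Qed.

Fact laurent_map_monoid_morphism : monoid_morphism (laurent_map h).
Proof.
split=> [|f g]; first by rewrite laurent_map_of_fps rmorph1.
have Bf := @lboundP _ f; have Bg := @lboundP _ g.
rewrite -[RHS]/(laurent_mul _ _).
rewrite (laurent_mulE (bounded_laurent_map Bf) (bounded_laurent_map Bg)).
rewrite laurent_map_of_fps rmorphM.
by congr (laurent_of_fps _ (_ * _)); apply: fpsP.
Qed.
HB.instance Definition _ := GRing.isMonoidMorphism.Build
  (laurent R) (laurent S) (laurent_map h) laurent_map_monoid_morphism.

Lemma laurent_map_lmon c j : laurent_map h (lmon c j) = lmon (h c) j.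
Proof. by apply: laurentP => i /=; case: ifP; rewrite ?rmorph0. Qed.

End FpsMorphism.

Section LaurentRing.
Variable R : comNzRingType.
Implicit Types (f g : laurent R) (F G : fps R).

Lemma coef_laurent0 j : (0 : laurent R) j = 0. Proof. by []. Qed.
Lemma coef_laurentD f g j : (f + g) j = f j + g j. Proof. by []. Qed.
Lemma coef_laurentN f j : (- f) j = - f j. Proof. by []. Qed.
Lemma coef_laurent_sum I (r : seq I) (P : pred I) (F : I -> laurent R) j :
  (\sum_(i <- r | P i) F i) j = \sum_(i <- r | P i) F i j.
Proof.
by elim/big_rec2: _ => [|i y x _ <-]; rewrite ?coef_laurent0 ?coef_laurentD.
Qed.

Lemma laurent_of_fpsM N M F G :
  laurent_of_fps N F * laurent_of_fps M G = laurent_of_fps (N + M) (F * G).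
Proof.
rewrite -[LHS]/(laurent_mul _ _).
have bound := @laurent_of_fps_bound R.
by rewrite (laurent_mulE (bound N F) (bound M G)) !laurent_of_fpsK.
Qed.

Lemma coef_lmonM c i f j : (lmon c i * f) j = c * f (j - i).
Proof.
have Bi : bounded_at i (lmon c i).
  by move=> k lt /=; rewrite lt_eqF.
have Bf := @lboundP _ f; set M := lbound f in Bf.
rewrite -[lmon c i * f]/(laurent_mul _ _).
have [lt|le] := ltP j (i + M).
  rewrite Bf; last by lia.
  by rewrite (laurent_mulE Bi Bf) laurent_of_fps_bound // mulr0.
have [n nE] : exists n : nat, j = i + M + n%:Z.
  by exists `|(j - (i + M))%R|%N; lia.
rewrite nE coef_laurent_mul // big_ord_recl /= addr0 eqxx big1 ?addr0.
  by congr (c * f _); lia.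
move=> k _; rewrite (_ : _ == _ = false) ?mul0r //=.
by apply/negP => /eqP; rewrite /bump /=; lia.
Qed.

Lemma lmonM c d i j : lmon c i * lmon d j = lmon (c * d) (i + j) :> laurent R.
Proof.
apply: laurentP => k; rewrite coef_lmonM /=.
have -> : (k - i == j) = (k == i + j) by apply/eqP/eqP; lia.
by case: ifP; rewrite ?mulr0.
Qed.

Lemma lmon1 : lmon 1 0 = 1 :> laurent R.
Proof. by apply: laurentP => -[[|n]|n] //=. Qed.

Fact lconst_monoid_morphism : monoid_morphism (@lconst R).
Proof. by split=> [|c d]; rewrite /lconst ?lmon1 ?lmonM ?addr0. Qed.
HB.instance Definition _ := GRing.isMonoidMorphism.Build
  R (laurent R) (@lconst R) lconst_monoid_morphism.

Lemma coef_lconstM c f j : (lconst c * f) j = c * f j.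
Proof. by rewrite coef_lmonM subr0. Qed.

Fact laurent_fps_zmod_morphism : zmod_morphism (@laurent_fps R).
Proof. by move=> F G; apply: laurentP => j /=; case: ifP; rewrite ?subr0. Qed.
HB.instance Definition _ := GRing.isZmodMorphism.Build
  (fps R) (laurent R) (@laurent_fps R) laurent_fps_zmod_morphism.

Fact laurent_fps_monoid_morphism : monoid_morphism (@laurent_fps R).
Proof. by split=> // F G; rewrite /laurent_fps laurent_of_fpsM addr0. Qed.
HB.instance Definition _ := GRing.isMonoidMorphism.Build
  (fps R) (laurent R) (@laurent_fps R) laurent_fps_monoid_morphism.

Lemma laurent_fps_inj : injective (@laurent_fps R).
Proof.
move=> F G FG; have := congr1 (fps_of_laurent 0) FG.
by rewrite !laurent_of_fpsK.
Qed.

Lemma laurent_of_fpsE N F : laurent_of_fps N F = lmon 1 N * laurent_fps F.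
Proof.
apply: laurentP => j; rewrite coef_lmonM mul1r /= subr0 subr_ge0.
by case: ifP.
Qed.

Lemma laurent_fpsX d : laurent_fps (fpsX d) = lmon 1 d%:Z :> laurent R.
Proof.
apply: laurentP => -[j|j] //=.
by rewrite addn0 eqz_nat; case: ifP.
Qed.

End LaurentRing.

Section Ramification.
Variable R : comNzRingType.
Variable L : nat.

Fact ramify_zmod_morphism : zmod_morphism (@ramify R L.+1).
Proof. by move=> f g; apply: fpsP => n /=; case: ifP; rewrite ?subr0. Qed.
HB.instance Definition _ := GRing.isZmodMorphism.Build
  (fps R) (fps R) (@ramify R L.+1) ramify_zmod_morphism.

Fact ramify_monoid_morphism : monoid_morphism (@ramify R L.+1).
Proof.
split=> [|f g]; apply: fpsP => n /=.
  case: ifP => [/dvdnP[q ->]|].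
    by rewrite mulnK // muln_eq0 orbF.
  by case: n => //; rewrite dvdn0.
pose F i := ramify L.+1 f i * ramify L.+1 g (n - i)%N.
rewrite -[RHS]/(\sum_(i < n.+1) F i).
case: ifP => [/dvdnP[q nE]|ndv]; last first.
  rewrite big1 // => i _; rewrite /F /=.
  case: ifP => [di|_]; last by rewrite mul0r.
  case: ifP => [dni|_]; last by rewrite mulr0.
  by have := dvdn_add di dni; rewrite subnKC ?ndv // leq_ord.
have -> : (n %/ L.+1)%N = q by rewrite nE mulnK.
(* Terms whose index is not a multiple of L+1 vanish; the others are reindexed by the quotient. *)
rewrite (bigID (fun i : 'I_n.+1 => (L.+1 %| i)%N)) /=.
rewrite [X in _ = _ + X]big1 ?addr0; last first.
  by move=> i /negPf ndi; rewrite /F /= ndi mul0r.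
have lt_i (i : 'I_q.+1) : (i * L.+1 < n.+1)%N.
  by rewrite nE ltnS leq_mul2r leq_ord orbT.
pose phi i := Ordinal (lt_i i).
pose psi (i : 'I_n.+1) : 'I_q.+1 := inord (i %/ L.+1).
rewrite (reindex_onto phi psi) /=; last first.
  move=> i /dvdnP[m mE]; apply: val_inj; rewrite /= /psi inordK mE mulnK //.
  by have := leq_ord i; rewrite mE nE leq_pmul2r.
apply: eq_big => [i|i _].
  rewrite dvdn_mull // eq_sym; apply/esym/eqP/val_inj.
  by rewrite /= inordK ?mulnK.
by rewrite /F /= nE -mulnBl !dvdn_mull ?mulnK.
Qed.
HB.instance Definition _ := GRing.isMonoidMorphism.Build
  (fps R) (fps R) (@ramify R L.+1) ramify_monoid_morphism.

End Ramification.

Lemma ramify_ramify (R : comNzRingType) L M (f : fps R) : (0 < M)%N ->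
  ramify M (ramify L f) = ramify (L * M) f.
Proof.
move=> M0; apply: fpsP => n /=; case: ifP => [/dvdnP[q ->]|ndv].
  by rewrite mulnK // dvdn_pmul2r // divnMr.
by case: ifP => // /dvdnP[q nE]; rewrite nE mulnA dvdn_mull in ndv.
Qed.

Section SeriesField.
Variable F : fieldType.

Lemma fps_inv (f : fps F) : f 0%N != 0 -> exists g : fps F, g * f = 1.
Proof.
move=> f0.
(* The equation (g f)_n = [n = 0], solved for g_n. *)
pose step n (g : nat -> F) :=
  ((n == 0)%N%:R - \sum_(i < n) g i * f (n - i)%N) / f 0%N.
have [|g gE] := @course_of_values F 0 step.
  by move=> n u v uv; rewrite /step; under eq_bigr do rewrite uv //.
exists (Fps g); apply: fpsP => n; rewrite coef_fpsM big_ord_recr /= subnn.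
by rewrite [X in _ + X * _]gE /step divfK // addrC subrK.
Qed.

(** Factoring out the lowest power of the variable leaves a power series with nonzero constant term,
    which is invertible; hence F((t)) is a field. *)
Lemma fps_of_laurent_unit (f : laurent F) : f != 0 ->
  exists N G, f = lmon 1 N * laurent_fps G /\ G 0%N != 0.
Proof.
move=> fn0; have fE := fps_of_laurentK (@lboundP _ f).
set N := lbound f in fE; set H := fps_of_laurent N f in fE.
have [|d Hd H0] := @fps_neq0 _ H.
  by apply: contraNneq fn0 => H0; rewrite -fE H0 laurent_of_fpsE rmorph0 mulr0.
exists (N + d%:Z), (fps_shift d H); split => //.
rewrite -fE -{1}(fps_shiftK H0) laurent_of_fpsE rmorphM /=.
by rewrite laurent_fpsX mulrA lmonM mulr1.
Qed.

Lemma laurent_inv (f : laurent F) : f != 0 -> exists g : laurent F, g * f = 1.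
Proof.
case/fps_of_laurent_unit=> N [G [-> /fps_inv[H HG]]].
exists (lmon 1 (- N) * laurent_fps H).
by rewrite mulrACA lmonM -rmorphM HG rmorph1 mulr1 addNr mulr1 lmon1.
Qed.

Definition laurent_invf (f : laurent F) : laurent F :=
  if pselect (f != 0) is left fn0 then projT1 (cid (laurent_inv fn0)) else 0.

Fact laurent_mulVf (f : laurent F) : f != 0 -> laurent_invf f * f = 1.
Proof.
move=> fn0; rewrite /laurent_invf; case: pselect => // fn1.
exact: projT2 (cid (laurent_inv fn1)).
Qed.

Fact laurent_invf0 : laurent_invf 0 = 0.
Proof. by rewrite /laurent_invf; case: pselect => // n0; case/eqP: (n0). Qed.

HB.instance Definition _ := GRing.ComNzRing_isField.Build (laurent F)
  laurent_mulVf laurent_invf0.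

End SeriesField.

(** * Hensel's lemma and the Newton-Puiseux theorem *)

Section PolyFps.
Variable R : comNzRingType.
Implicit Types p q : {poly fps R}.

(** Views R[[t]][X] inside R[X][[t]]; the slice of order 0 is the reduction modulo t. *)
Definition poly_slice n p : {poly R} := map_poly (fun f : fps R => f n) p.

Lemma coef_poly_slice n p i : (poly_slice n p)`_i = p`_i n.
Proof. by rewrite coef_map_id0. Qed.

Lemma poly_sliceP p q : (forall n, poly_slice n p = poly_slice n q) -> p = q.
Proof.
move=> pq; apply/polyP => i; apply: fpsP => n.
by rewrite -!coef_poly_slice pq.
Qed.

Lemma poly_sliceM n p q :
  poly_slice n (p * q) = \sum_(i < n.+1) poly_slice i p * poly_slice (n - i) q.
Proof.
apply/polyP => k; rewrite coef_poly_slice coef_sum coefM coef_fps_sum.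
under eq_bigr do rewrite coef_fpsM.
rewrite exchange_big; apply: eq_bigr => i _; rewrite coefM.
by apply: eq_bigr => j _; rewrite !coef_poly_slice.
Qed.

Lemma size_poly_slice n p : (size (poly_slice n p) <= size p)%N.
Proof. exact: size_poly. Qed.

Lemma monic_coef1 (S : nzRingType) (p : {poly S}) m :
  (size p <= m.+1)%N -> p`_m = 1 -> p \is monic /\ size p = m.+1.
Proof.
move=> sp pm; have szp : size p = m.+1.
  apply/eqP; rewrite eqn_leq sp ltnNge.
  apply/negP => /leq_sizeP/(_ m (leqnn m)).
  by rewrite pm => /eqP; rewrite oner_eq0.
by split=> //; rewrite monicE lead_coefE szp pm.
Qed.

Lemma monic_poly_slice0 p :
  p \is monic -> poly_slice 0 p \is monic /\ size (poly_slice 0 p) = size p.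
Proof.
move=> pm; have sp : (0 < size p)%N by rewrite size_poly_gt0 monic_neq0.
rewrite -(prednK sp); apply: monic_coef1.
  by rewrite prednK // size_poly_slice.
by rewrite coef_poly_slice -lead_coefE (monicP pm).
Qed.

(** The leading coefficient is the constant series 1, so the terms of positive order in t involve
    only lower powers of X. *)
Lemma size_poly_sliceS n p :
  p \is monic -> (size (poly_slice n.+1 p) < size p)%N.
Proof.
move=> pm; have sp : (0 < size p)%N by rewrite size_poly_gt0 monic_neq0.
rewrite -[X in (_ < X)%N](prednK sp) ltnS; apply/leq_sizeP => j lej.
rewrite coef_poly_slice; move: lej; rewrite leq_eqVlt => /predU1P[<-|ltj].
  by rewrite -lead_coefE (monicP pm).
by rewrite nth_default // -(prednK sp).
Qed.

End PolyFps.

Lemma coef_exp_XsubC (R : comNzRingType) (e : R) n :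
  (('X - e%:P) ^+ n.+1)`_n = - (e *+ n.+1).
Proof.
elim: n => [|n IH]; first by rewrite expr1 coefB coefX coefC sub0r.
have top : (('X - e%:P) ^+ n.+1)`_n.+1 = 1.
  have /monicP := monic_exp n.+1 (monicXsubC e).
  by rewrite lead_coefE size_exp_XsubC.
rewrite exprS mulrBl coefB coefXM IH /= coefCM top mulr1.
by rewrite [in RHS]mulrSr opprD.
Qed.

Lemma monic_comp_XsubC (R : comNzRingType) (e : R) n (p : {poly R}) :
    p \is monic -> size p = n.+1 ->
  p \Po ('X - e%:P) \is monic /\ size (p \Po ('X - e%:P)) = n.+1.
Proof.
move=> pm sp; apply: monic_coef1.
  by apply: (leq_trans (size_comp_poly_leq _ _)); rewrite size_XsubC sp muln1.
rewrite comp_polyE sp big_ord_recr /= coefD coef_sum big1 ?add0r.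
  have := monicP pm; rewrite lead_coefE sp coefZ => -> /=; rewrite mul1r.
  have := monicP (monic_exp n (monicXsubC e)).
  by rewrite lead_coefE size_exp_XsubC.
by move=> i _; rewrite coefZ [X in _ * X]nth_default ?mulr0 // size_exp_XsubC.
Qed.

(** Only the two top powers of X - e reach degree n. The term (n+1) e is what lets a translation
    cancel the subleading coefficient. *)
Lemma coef_comp_XsubC (R : comNzRingType) (e : R) n (p : {poly R}) :
    p \is monic -> size p = n.+2 ->
  (p \Po ('X - e%:P))`_n = p`_n - e *+ n.+1.
Proof.
move=> pm sp.
rewrite comp_polyE sp 2!big_ord_recr /= !coefD coef_sum big1 ?add0r.
  have := monicP pm; rewrite lead_coefE sp !coefZ => -> /=.
  rewrite mul1r coef_exp_XsubC.
  have := monicP (monic_exp n (monicXsubC e)).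
  by rewrite lead_coefE size_exp_XsubC => ->; rewrite mulr1.
by move=> i _; rewrite coefZ [X in _ * X]nth_default ?mulr0 // size_exp_XsubC.
Qed.

Section Hensel.
Variable F : fieldType.

(** Bezout gives e = e u g + e v h. Replacing e v by its remainder a modulo g bounds a; then b g = e
    - a h has degree below that of g h, which bounds b. *)
Lemma coprimep_split (g h e : {poly F}) :
    coprimep g h -> g != 0 -> h != 0 -> (size e < size (g * h)%R)%N ->
  exists a b, [/\ a * h + g * b = e, (size a < size g)%N & (size b < size h)%N].
Proof.
move=> cop g0 h0 se; have [[u v] /= uv] := Bezout_eq1_coprimepP _ _ cop.
pose a := (e * v) %% g.
have sa : (size a < size g)%N by rewrite ltn_modp.
have /dvdpP[b bE] : g %| e - a * h.
  have -> : e - a * h = (e * u + (e * v) %/ g * h) * g.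
    have := divp_eq (e * v) g; rewrite -/a => evE.
    have -> : a = e * v - (e * v) %/ g * g by rewrite {1}evE; ring.
    transitivity (e * (u * g + v * h) - (e * v - (e * v) %/ g * g) * h).
      by rewrite uv mulr1.
    by ring.
  exact: dvdp_mull.
exists a, b; split=> //; first by rewrite [g * b]mulrC -bE; ring.
have [->|b0] := eqVneq b 0; first by rewrite size_poly0 size_poly_gt0.
have szg : (0 < size g)%N by rewrite size_poly_gt0.
have szh : (0 < size h)%N by rewrite size_poly_gt0.
have : (size (b * g)%R < size (g * h)%R)%N.
  rewrite -bE (leq_ltn_trans (size_polyD _ _)) // size_polyN gtn_max se /=.
  have [->|a0] := eqVneq a 0.
    by rewrite mul0r size_poly0 size_poly_gt0 mulf_neq0.
  have sza : (0 < size a)%N by rewrite size_poly_gt0.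
  rewrite !size_mul //; move: sa sza szg szh.
  by move: (size a) (size g) (size h) => x y z; lia.
rewrite !size_mul //; have szb : (0 < size b)%N by rewrite size_poly_gt0.
by move: szb szg szh; move: (size b) (size g) (size h) => x y z; lia.
Qed.

(** Lifting proceeds one power of t at a time: the slices a of G and b of H solve a h + g b = known
    terms. The degree bounds on a and b leave the leading terms of g and h untouched, so G and H are
    monic of the same degrees. *)
Lemma hensel (p : {poly fps F}) (g h : {poly F}) :
    p \is monic -> g \is monic -> h \is monic -> coprimep g h ->
    poly_slice 0 p = g * h ->
  exists G H, [/\ p = G * H, G \is monic, H \is monic,
    size G = size g & size H = size h].
Proof.
move=> pm gm hm cop p0.
have g0 := monic_neq0 gm; have h0 := monic_neq0 hm.
have /choice[sol solP] : forall e : {poly F}, exists ab : {poly F} * {poly F},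
    (size e < size (g * h)%R)%N ->
    [/\ ab.1 * h + g * ab.2 = e, (size ab.1 < size g)%N
      & (size ab.2 < size h)%N].
  (* Outside the degree bound the value 0 is a placeholder. *)
  move=> e; have [se|_] := boolP (size e < size (g * h)%R)%N; last by exists 0.
  by have [a [b ab]] := coprimep_split cop g0 h0 se; exists (a, b).
(* The t^n slice of p minus the products of two slices of positive order, all known at stage n. *)
pose err n (f : nat -> {poly F} * {poly F}) :=
  poly_slice n p - \sum_(1 <= i < n) (f i).1 * (f (n - i)%N).2.
pose step n f := if n is 0 then (g, h) else sol (err n f).
have [|f fE] := @course_of_values _ 0 step.
  move=> [|n] u v uv //=; congr (sol (_ - _)).
  by rewrite !big_nat; apply: eq_bigr => i ilt; rewrite !uv //; lia.
have f0 : f 0%N = (g, h) by rewrite fE.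
have szp : size p = size (g * h)%R by rewrite -p0 (monic_poly_slice0 pm).2.
have szgh : (size (g * h)%R = (size g + size h).-1)%N by rewrite size_mul.
have fS n : [/\ (f n.+1).1 * h + g * (f n.+1).2 = err n.+1 f,
    (size (f n.+1).1 < size g)%N & (size (f n.+1).2 < size h)%N].
  elim/ltn_ind: n => n IH; rewrite fE /=; apply: solP.
  rewrite /err (leq_ltn_trans (size_polyD _ _)) // gtn_max -{1}szp.
  rewrite size_poly_sliceS //= size_polyN big_nat.
  apply: (@leq_ltn_trans (size g + size h).-2); last first.
    rewrite szgh; move: (size_poly_gt0 g) (size_poly_gt0 h); rewrite g0 h0.
    by lia.
  apply: (leq_trans (size_sum _ _ _)); apply/bigmax_leqP_seq => i _ ilt.
  apply: (leq_trans (size_polyMleq _ _)).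
  have [|_ + _] := IH i.-1; first by lia.
  have [|_ _] := IH (n - i)%N; first by lia.
  rewrite prednK ?subSn //; try lia.
  move: (size (f i).1) (size (f (n - i).+1).2) (size g) (size h) => x y z w.
  by lia.
have s1 n : (size (f n).1 <= size g)%N.
  by case: n => [|n]; rewrite ?f0 //; have [_ /ltnW] := fS n.
have s2 n : (size (f n).2 <= size h)%N.
  by case: n => [|n]; rewrite ?f0 //; have [_ _ /ltnW] := fS n.
pose G := \poly_(i < size g) Fps (fun n => (f n).1`_i).
pose H := \poly_(i < size h) Fps (fun n => (f n).2`_i).
have sG n : poly_slice n G = (f n).1.
  apply/polyP => i; rewrite coef_poly_slice coef_poly; case: ltnP => // le.
  by rewrite nth_default // (leq_trans (s1 n)).
have sH n : poly_slice n H = (f n).2.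
  apply/polyP => i; rewrite coef_poly_slice coef_poly; case: ltnP => // le.
  by rewrite nth_default // (leq_trans (s2 n)).
have gg : (0 < size g)%N by rewrite size_poly_gt0.
have hh : (0 < size h)%N by rewrite size_poly_gt0.
have [Gm szG] : G \is monic /\ size G = (size g).-1.+1.
  apply: monic_coef1; first by rewrite prednK // size_poly.
  rewrite coef_poly prednK // leqnn; apply: fpsP => -[|n] /=.
    by rewrite f0 -lead_coefE (monicP gm).
  by have [_ + _] := fS n; rewrite -{1}(prednK gg) ltnS => /leq_sizeP->.
have [Hm szH] : H \is monic /\ size H = (size h).-1.+1.
  apply: monic_coef1; first by rewrite prednK // size_poly.
  rewrite coef_poly prednK // leqnn; apply: fpsP => -[|n] /=.
    by rewrite f0 -lead_coefE (monicP hm).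
  by have [_ _] := fS n; rewrite -{1}(prednK hh) ltnS => /leq_sizeP->.
exists G, H; split; rewrite ?szG ?szH ?prednK //.
apply: poly_sliceP => n; rewrite poly_sliceM.
under eq_bigr do rewrite sG sH.
case: n => [|n]; first by rewrite big_ord1 f0 p0.
rewrite big_ord_recl big_ord_recr /= subnn f0 /= subn0.
have [fnE _ _] := fS n.
set S := (X in _ + (X + _)).
transitivity (err n.+1 f + S); last by rewrite -fnE; ring.
by rewrite /err big_add1 big_mkord; apply/esym/subrK.
Qed.

End Hensel.

Section Puiseux.
Variable F : closedFieldType.
Implicit Types q G H : {poly fps F}.
Hypothesis charF0 : [pchar F] =i pred0.

(** A root z of multiplicity m gives the factor (X - z)^m, prime to its cofactor. Were the cofactor
    constant, p would be (X - z)^(n+1); its subleading coefficient -(n+1) z vanishes only for z = 0,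
    and X^(n+1) has no nonzero lower coefficient. *)
Lemma split_depressed_poly (p : {poly F}) n k :
    p \is monic -> size p = n.+2 -> p`_n = 0 -> (k <= n)%N -> p`_k != 0 ->
  exists g h, [/\ p = g * h, g \is monic, h \is monic, coprimep g h &
    (1 < size g)%N /\ (1 < size h)%N].
Proof.
move=> pm sp pn0 lekn pk.
have /closed_rootP[z pz] : size p != 1%N by rewrite sp.
have [m [q qz pE]] := multiplicity_XsubC p z; rewrite monic_neq0 //= in qz.
have hm : ('X - z%:P) ^+ m \is monic by rewrite monic_exp // monicXsubC.
have qm : q \is monic by rewrite -(monicMr _ hm) -pE.
have m0 : (0 < m)%N.
  by rewrite lt0n; apply: contraTneq pz => m0; rewrite pE m0 expr0 mulr1.
exists (('X - z%:P) ^+ m), q; split=> //; first by rewrite mulrC.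
  by rewrite coprimep_expl // coprimep_sym coprimep_XsubC.
split; first by rewrite size_exp_XsubC.
have q0 := monic_neq0 qm.
rewrite ltn_neqAle size_poly_gt0 q0 andbT eq_sym.
apply/negP => /size_poly1P[c c0 qE].
have {c0}c1 : c = 1 by have := monicP qm; rewrite qE lead_coefC.
have pE' : p = ('X - z%:P) ^+ m by rewrite pE qE c1 mul1r.
have mE : m = n.+1 by move: sp; rewrite pE' size_exp_XsubC => -[].
move: pn0; rewrite pE' mE coef_exp_XsubC => /eqP.
rewrite oppr_eq0 -mulr_natr mulf_eq0 (negPf (natr_neq0 charF0 _)) orbF.
move=> /eqP z0.
by move: pk; rewrite pE' mE z0 subr0 coefXn ltn_eqF ?eqxx.
Qed.

(* t^(d m) q(X / t^d), for q of degree m *)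
Definition poly_dilate d m (q : {poly fps F}) : {poly fps F} :=
  \poly_(k < m.+1) (fpsX (d * (m - k)) * q`_k).

Lemma coef_poly_dilate d m q k : (size q <= m.+1)%N ->
  (poly_dilate d m q)`_k = fpsX (d * (m - k)) * q`_k.
Proof.
move=> sq; rewrite coef_poly; case: ltnP => // ltmk.
by rewrite [q`_k]nth_default ?mulr0 // (leq_trans sq).
Qed.

Lemma monic_poly_dilate d m q : q \is monic -> size q = m.+1 ->
  poly_dilate d m q \is monic /\ size (poly_dilate d m q) = m.+1.
Proof.
move=> qm sq; apply: monic_coef1; first exact: size_poly.
rewrite coef_poly_dilate ?sq // subnn muln0 fpsX0 mul1r.
by have := monicP qm; rewrite lead_coefE sq.
Qed.

(** The weights d (m - k) add up under multiplication, as in the homogenization of polynomials. *)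
Lemma poly_dilateM d a b G H : (size G <= a.+1)%N -> (size H <= b.+1)%N ->
  poly_dilate d (a + b) (G * H) = poly_dilate d a G * poly_dilate d b H.
Proof.
move=> sG sH; apply/polyP => k.
have sGH : (size (G * H)%R <= (a + b).+1)%N.
  by apply: (leq_trans (size_polyMleq _ _)); lia.
rewrite coef_poly_dilate // !coefM mulr_sumr; apply: eq_bigr => i _.
rewrite !coef_poly_dilate //.
have [lea|lta] := leqP i a; last first.
  by rewrite [G`_i]nth_default ?(mul0r, mulr0) // (leq_trans sG).
have [leb|ltb] := leqP (k - i) b; last first.
  by rewrite [H`_(k - i)]nth_default ?(mul0r, mulr0) // (leq_trans sH).
rewrite mulrACA -fpsXD -mulnDr; congr (fpsX (_ * _) * _).
by have := ltn_ord i; lia.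
Qed.

(* Substituting t = u^L, where -d/L is the steepest slope of the Newton
   polygon, and X = u^d Y gives an integral polynomial in Y whose reduction is
   not a power of Y. *)
Lemma split_depressed (p : {poly fps F}) n :
    p \is monic -> size p = n.+3 -> p`_n.+1 = 0 ->
  exists L G H, [/\ map_poly (ramify L.+1) p = G * H, G \is monic, H \is monic,
    (1 < size G)%N & (1 < size H)%N].
Proof.
have degrees x y z : (1 < x -> 1 < y -> z.+3 = (x + y).-1 ->
    z.+2 = x.-1 + y.-1)%N by lia.
move=> pm sp pn.
have pn2 : p`_n.+2 = 1 by have := monicP pm; rewrite lead_coefE sp.
(* When all lower coefficients vanish there is no slope to choose, and the factor X is explicit. *)
have [pX|pX] := eqVneq p 'X^(n.+2).
  exists 0%N, 'X, 'X^(n.+1).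
  rewrite monicX monicXn size_polyX size_polyXn; split=> //.
  by rewrite pX map_polyXn exprS.
have [k0 pk0] : exists k : 'I_n.+2, p`_k != 0.
  apply/existsP; apply: contraNT pX => /existsPn p0; apply/eqP/polyP => k.
  rewrite coefXn; case: (ltngtP k n.+2) => [ltk|ltk|->//].
    by have := p0 (Ordinal ltk); rewrite negbK => /eqP.
  by rewrite nth_default ?sp //.
(* [v k] is the t-adic valuation of the coefficient of X^k, unconstrained when that coefficient is
   zero. *)
have /choice[v vP] : forall k, exists v, p`_k != 0 ->
    p`_k v != 0 /\ forall i, (i < v)%N -> p`_k i = 0.
  move=> k; have [_|/fps_neq0[v]] := eqVneq (p`_k) 0; first by exists 0%N.
  by exists v.
pose slope (k : 'I_n.+2) : rat := (v k)%:R / (n.+2 - k)%:R.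
have [k1 pk1 k1min] :=
  @arg_minP _ _ _ k0 (fun k : 'I_n.+2 => p`_k != 0) slope pk0.
(* The minimal slope is d / (L+1); the fraction need not be reduced. *)
set d := v k1; have [L LE] : exists L, (n.+2 - k1)%N = L.+1.
  by exists (n.+2 - k1).-1; have := ltn_ord k1; lia.
have minL (k : 'I_n.+2) : p`_k != 0 -> (d * (n.+2 - k) <= v k * L.+1)%N.
  move=> /k1min; rewrite /slope -/d LE ler_pdivrMr ?ltr0n // mulrAC.
  rewrite ler_pdivlMr; last by rewrite ltr0n subn_gt0.
  by rewrite -!natrM ler_nat.
(* By [minL], u^(d (n+2-k)) divides the ramified coefficient of X^k; the shift performs this
   division. *)
pose pt := \poly_(k < n.+3) fps_shift (d * (n.+2 - k)) (ramify L.+1 p`_k).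
have ptE : map_poly (ramify L.+1) p = poly_dilate d n.+2 pt.
  apply/polyP => k; rewrite coef_map coef_poly_dilate ?size_poly //= coef_poly.
  have [ltk|lek] := ltnP; last by rewrite nth_default ?sp // rmorph0 mulr0.
  rewrite fps_shiftK // => i lti /=; case: ifP => // /dvdnP[q iE].
  have [->//|pk] := eqVneq (p`_k) 0.
  have ltk' : (k < n.+2)%N.
    rewrite ltn_neqAle -ltnS ltk andbT; apply: contraTneq lti => ->.
    by rewrite subnn muln0.
  have [_] := vP k pk; apply; rewrite iE mulnK //.
  by have := leq_trans lti (minL (Ordinal ltk') pk); rewrite iE ltn_pmul2r.
have [ptm spt] : pt \is monic /\ size pt = n.+3.
  apply: monic_coef1; first exact: size_poly.
  rewrite coef_poly ltnSn subnn muln0 pn2 rmorph1; apply: fpsP => i /=.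
  by rewrite addn0.
have [pt0m spt0] := monic_poly_slice0 ptm.
(* At [k1] the minimum is attained, so that coefficient of the reduction is nonzero, while the
   subleading one is still zero. *)
have [||||g [h [pt0E gm hm cop [sg sh]]]] :=
    @split_depressed_poly (poly_slice 0 pt) n.+1 k1 pt0m.
- by rewrite spt0 spt.
- rewrite coef_poly_slice coef_poly pn rmorph0; case: ifP => //.
- by have := ltn_ord k1.
- rewrite coef_poly_slice coef_poly ltnS ltnW //= LE dvdn_mull // mulnK //.
  by have [] := vP k1 pk1.
have [G [H [GH Gm Hm szG szH]]] := hensel ptm gm hm cop pt0E.
have eG : size G = (size G).-1.+1 by rewrite prednK // szG ltnW.
have eH : size H = (size H).-1.+1 by rewrite prednK // szH ltnW.
have [Gm' sG'] := monic_poly_dilate d Gm eG.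
have [Hm' sH'] := monic_poly_dilate d Hm eH.
exists L, (poly_dilate d (size G).-1 G), (poly_dilate d (size H).-1 H).
split=> //; rewrite ?sG' ?sH' -?eG -?eH ?szG ?szH //.
rewrite ptE -poly_dilateM ?szG ?szH ?leqSpred // -GH; congr poly_dilate.
have := congr1 (fun q : {poly fps F} => size q) GH.
rewrite spt size_monicM ?monic_neq0 // szG szH.
exact: degrees sg sh.
Qed.

(** Translating X by p_(n+1) / (n+2), a division allowed in characteristic zero, kills the
    subleading coefficient. The factors found after ramification are translated back by the ramified
    amount. *)
Lemma split_monic (p : {poly fps F}) n : p \is monic -> size p = n.+3 ->
  exists L G H, [/\ map_poly (ramify L.+1) p = G * H, G \is monic, H \is monic,
    (1 < size G)%N & (1 < size H)%N].
Proof.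
move=> pm sp; pose e := fpsC (n.+2%:R)^-1 * p`_n.+1.
have [qm sq] := monic_comp_XsubC e pm sp.
have [|L [G [H [GH Gm Hm sG sH]]]] := split_depressed qm sq.
  rewrite (coef_comp_XsubC e pm sp) /e -mulrnAl -mulr_natr.
  have -> : fpsC (n.+2%:R)^-1 * n.+2%:R = 1 :> fps F.
    rewrite mulr_natr; apply: fpsP => i.
    have coefMn (f : fps F) m : (f *+ m) i = f i *+ m.
      by elim: m => // m IH; rewrite !mulrS coef_fpsD IH.
    rewrite coefMn /=; case: eqP => _; last by rewrite mul0rn.
    by rewrite -[LHS]mulr_natr mulVf // natr_neq0.
  by rewrite mul1r subrr.
pose e' := - ramify L.+1 e.
have comp_monic (g : {poly fps F}) : g \is monic -> (1 < size g)%N ->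
    g \Po ('X - e'%:P) \is monic /\ (1 < size (g \Po ('X - e'%:P)))%N.
  move=> gm sg; have eg : size g = (size g).-1.+1 by rewrite prednK // ltnW.
  by have [gm' sg'] := monic_comp_XsubC e' gm eg; rewrite sg' -eg.
have [Gm' sG'] := comp_monic G Gm sG; have [Hm' sH'] := comp_monic H Hm sH.
exists L, (G \Po ('X - e'%:P)), (H \Po ('X - e'%:P)); split=> //.
rewrite -comp_polyM -GH map_comp_poly rmorphB /= map_polyX map_polyC /=.
rewrite -comp_polyA comp_polyB comp_polyX comp_polyC /e' polyCN opprK addrK.
by rewrite comp_polyXr.
Qed.

Theorem puiseux (p : {poly fps F}) : p \is monic ->
  exists L rs, map_poly (ramify L.+1) p = \prod_(r <- rs) ('X - r%:P).
Proof.
have [n] := ubnP (size p); elim: n p => // n IH p sp pm.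
case sz: (size p) => [|[|[|m]]].
- by move/monic_neq0: pm; rewrite -size_poly_eq0 sz.
- exists 0%N, [::]; rewrite big_nil.
  have /size1_polyC pE : (size p <= 1)%N by rewrite sz.
  have := monicP pm; rewrite lead_coefE sz /= => p0.
  by rewrite pE p0 polyC1 rmorph1.
- exists 0%N, [:: - ramify 1 p`_0]; rewrite big_seq1; apply/polyP => i.
  rewrite coef_map coefB coefX coefC /=.
  have := monicP pm; rewrite lead_coefE sz /= => p1.
  case: i => [|[|i]] /=; first by rewrite sub0r opprK.
    by rewrite p1 rmorph1 subr0.
  by rewrite nth_default ?sz // rmorph0 subr0.
have [L [G [H [GH Gm Hm sG sH]]]] := split_monic pm sz.
have eGH : (size G + size H).-1 = size p.
  rewrite -size_monicM ?monic_neq0 // -GH size_map_poly_id0 //.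
  by rewrite (monicP pm) rmorph1 oner_neq0.
have [|L1 [rs1 E1]] := IH G _ Gm.
  by move: sG sH eGH sp; move: (size G) (size H) (size p) => x y z; lia.
have [|L2 [rs2 E2]] := IH H _ Hm.
  by move: sG sH eGH sp; move: (size G) (size H) (size p) => x y z; lia.
(* The two factors may need different ramifications; both are brought to the index
   (L+1)(L1+1)(L2+1). The predecessor only matches the [L.+1] convention. *)
exists (L.+1 * L1.+1 * L2.+1).-1.
exists (map (ramify L2.+1) rs1 ++ map (ramify L1.+1) rs2).
have -> : map_poly (ramify (L.+1 * L1.+1 * L2.+1).-1.+1) p =
    map_poly (ramify L2.+1)
      (map_poly (ramify L1.+1) (map_poly (ramify L.+1) p)).
  rewrite prednK ?muln_gt0 // -!map_poly_comp.
  by apply: eq_map_poly => f /=; rewrite !ramify_ramify // mulnA.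
rewrite GH !rmorphM /= E1 -[X in _ * X]map_poly_comp /=.
have -> : map_poly (ramify L2.+1 \o ramify L1.+1) H =
    map_poly (ramify L1.+1) (map_poly (ramify L2.+1) H).
  rewrite -map_poly_comp; apply: eq_map_poly => f /=.
  by rewrite !ramify_ramify // mulnC.
by rewrite E2 !map_prod_XsubC big_cat !big_map.
Qed.

End Puiseux.

(** * Generalized eigenvectors over Laurent series *)

(** For coprime factors, the kernel of the product is the sum of the kernels. Stacking the square
    kernel matrices keeps an eigenvalue [lam i] attached to each row, at the price of dependent
    rows. *)
Lemma kermxpoly_stack (F : fieldType) n (A : 'M[F]_n.+1) (rs : seq F)
    (e : F -> nat) :
    uniq rs ->
  exists m (M : 'M[F]_(m, n.+1)) (lam : 'I_m -> F),
    [/\ forall i, lam i \in rs,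
        forall i, row i M *m (A - (lam i)%:M) ^+ e (lam i) = 0
      & (kermxpoly A (\prod_(r <- rs) ('X - r%:P) ^+ e r) <= M)%MS].
Proof.
elim: rs => [_|r rs IH /= /andP[rrs /IH[m [M [lam [lamP MP Mker]]]]]].
  exists 0%N, 0, (fun=> 0).
  by split=> [[]//|[]//|]; rewrite big_nil kermxpoly1 sub0mx.
exists (n.+1 + m)%N, (col_mx (kermxpoly A (('X - r%:P) ^+ e r)) M).
exists (fun i => match split i with inl _ => r | inr j => lam j end).
split=> [i|i|].
- by case: split => [_|j]; rewrite ?mem_head // inE lamP orbT.
- rewrite -{1}(splitK i); case: split => j /=; last by rewrite rowKd MP.
  have -> : (A - r%:M) ^+ e r = horner_mx A (('X - r%:P) ^+ e r).
    by rewrite rmorphXn rmorphB /= horner_mx_X horner_mx_C.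
  by rewrite rowKu -row_mul mulmx_ker row0.
rewrite big_cons -addsmxE kermxpolyM ?addsmxS //.
rewrite coprimep_expl // big_seq (big_morph _ (coprimepMr _) (coprimep1 _)).
rewrite big_all_cond; apply/allP => s srs; apply/implyP => _.
rewrite coprimep_expr // coprimep_XsubC root_XsubC.
by apply: contraNneq rrs => <-.
Qed.

(** With the multiplicities as exponents the product is the characteristic polynomial, so
    Cayley-Hamilton gives the stack full rank, and an invertible selection of rows is extracted.
    Multiplicities are at most n+1, whence the uniform exponent. *)
Lemma generalized_eigenbasis (F : fieldType) n (A : 'M[F]_n.+1) (rs : seq F) :
    char_poly A = \prod_(r <- rs) ('X - r%:P) ->
  exists (V : 'M[F]_n.+1) (lam : 'I_n.+1 -> F),
    [/\ V \in unitmx, forall j, lam j \in rs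
      & forall j, row j V *m (A - (lam j)%:M) ^+ n.+1 = 0].
Proof.
move=> Ars; have [m [M [lam [lamP MP Mker]]]] :=
  kermxpoly_stack A (fun r => count_mem r rs) (undup_uniq rs).
have Mfull : row_full M.
  rewrite -sub1mx (submx_trans _ Mker) // prodr_undup_exp_count -Ars.
  by rewrite /kermxpoly Cayley_Hamilton kermx0.
exists (rowsub (fullrankfun Mfull) M), (lam \o fullrankfun Mfull).
split=> [|j|j]; first exact: fullrowsub_unit.
  by rewrite -mem_undup lamP.
rewrite row_rowsub /=; move: (fullrankfun Mfull j) => i.
have szrs : size rs = n.+1.
  by have := size_char_poly A; rewrite Ars size_prod_XsubC => -[].
have le : (count_mem (lam i) rs <= n.+1)%N by rewrite -szrs count_size.
by rewrite -[X in _ ^+ X](subnKC le) exprD mulmxA MP mul0mx.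
Qed.

Lemma laurent_clear_denom (F : fieldType) n (v : 'rV[laurent F]_n) :
  exists (N : int) (w : 'rV[fps F]_n),
    v = lmon 1 N *: map_mx (@laurent_fps F) w.
Proof.
pose lb (j : 'I_n) := `|lbound (v ord0 j)|%N.
pose N := - (\max_j lb j)%:Z.
exists N, (\row_j fps_of_laurent N (v 0 j)); apply/rowP => j.
rewrite !mxE -laurent_of_fpsE fps_of_laurentK //.
apply: bounded_atW (@lboundP _ _); rewrite /N.
have : (lb j <= \max_j lb j)%N by exact: leq_bigmax.
by rewrite {1}/lb; move: (\max_(i < n) lb i) (lbound (v 0 j)) => M b; lia.
Qed.

Lemma laurent_mul_fps_eq0 (F : fieldType) N m n (w : 'M[fps F]_(m, n)) :
  lmon 1 N *: map_mx (@laurent_fps F) w = 0 -> w = 0.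
Proof.
move=> w0; have := congr1 (fun M => lmon 1 (- N) *: M) w0.
rewrite scalerA lmonM addNr mulr1 lmon1 scale1r scaler0 => {}w0.
apply/matrixP => i j.
have := congr1 (fun M : 'M[laurent F]_(m, n) => M i j) w0.
by rewrite !mxE -(rmorph0 (@laurent_fps F)) => /laurent_fps_inj.
Qed.

(** Each eigenvector over F((t)) is rescaled by its own power of t. The determinant changes by a
    power of t, a unit of F((t)) though not of F[[t]] in general. *)
Lemma fps_generalized_eigenbasis (F : fieldType) n (A : 'M[fps F]_n.+1)
    (rs : seq (fps F)) :
    char_poly A = \prod_(r <- rs) ('X - r%:P) ->
  exists (V : 'M[fps F]_n.+1) (lam : 'I_n.+1 -> fps F),
    [/\ map_mx (@laurent_fps F) V \in unitmx, forall j, lam j \in rs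
      & forall j, row j V *m (A - (lam j)%:M) ^+ n.+1 = 0].
Proof.
move=> Ars; pose A' := map_mx (@laurent_fps F) A.
have A'rs : char_poly A' = \prod_(r <- map (@laurent_fps F) rs) ('X - r%:P).
  by rewrite -map_char_poly Ars map_prod_XsubC big_map.
have [V [lam [Vu lamP VP]]] := generalized_eigenbasis A'rs.
have /choice[mu muP] : forall j, exists mu, mu \in rs /\ lam j = laurent_fps mu.
  by move=> j; have /mapP[mu murs ->] := lamP j; exists mu.
have /choice[N /choice[w wP]] := fun j => laurent_clear_denom (row j V).
exists (\matrix_j w j), mu; split=> [|j|j]; last 1 first.
- apply: (@laurent_mul_fps_eq0 _ (N j)).
  rewrite rowK map_mxM scalemxAl -wP -[RHS](VP j) rmorphXn rmorphB /=.
  by rewrite map_scalar_mx (muP j).2 /=; congr (_ *m _).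
- have -> : map_mx (@laurent_fps F) (\matrix_j w j) =
      diag_mx (\row_j lmon 1 (- N j)) *m V.
    rewrite mul_diag_mx; apply/matrixP => j k; rewrite !mxE.
    have := congr1 (fun M : 'rV_n.+1 => M 0 k) (wP j); rewrite !mxE => ->.
    by rewrite mulrA lmonM addNr mulr1 lmon1 mul1r.
  rewrite unitmx_mul Vu andbT unitmxE det_diag unitfE; apply/prodf_neq0 => j _.
  rewrite mxE; apply/eqP => /(congr1 ( *%R (lmon 1 (N j)))).
  by rewrite mulr0 lmonM subrr mulr1 lmon1 => /eqP; rewrite oner_eq0.
- by have [] := muP j.
Qed.

(** * Differential operators *)

Section LogPoly.
Variable K : comNzRingType.
Implicit Types (f g : laurent K) (p q : logpoly K) (r c z : K).

Lemma coef_laurentMn f n j : (f *+ n) j = f j *+ n.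
Proof. by elim: n => // n IH; rewrite !mulrS coef_laurentD IH. Qed.

Lemma coef_lderiv f j : lderiv f j = (j + 1)%:~R * f (j + 1). Proof. by []. Qed.

Fact lderiv_zmod_morphism : zmod_morphism (@lderiv K).
Proof. by move=> f g; apply: laurentP => j /=; rewrite mulrBr. Qed.
HB.instance Definition _ := GRing.isZmodMorphism.Build
  (laurent K) (laurent K) (@lderiv K) lderiv_zmod_morphism.

Lemma lderiv_lmonM c m f :
  lderiv (lmon c m * f) = lmon c m * lderiv f + lmon (c * m%:~R) (m - 1) * f.
Proof.
apply: laurentP => j; rewrite coef_laurentD coef_lderiv !coef_lmonM coef_lderiv.
have -> : j - m + 1 = j + 1 - m by ring.
have -> : j - (m - 1) = j + 1 - m by ring.
by rewrite !rmorphB /= !rmorphD /=; ring.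
Qed.

Fact dx_zmod_morphism r : zmod_morphism (dx r).
Proof.
move=> p q; rewrite /dx [map_poly _ _]raddfB derivB !scalerBr.
by rewrite [X in X + _]addrACA [LHS]addrACA !opprD.
Qed.
HB.instance Definition _ r := GRing.isZmodMorphism.Build
  (logpoly K) (logpoly K) (dx r) (dx_zmod_morphism r).

Lemma map_lderiv_lmonZ c m p :
  map_poly (@lderiv K) (lmon c m *: p) =
  lmon c m *: map_poly (@lderiv K) p + lmon (c * m%:~R) (m - 1) *: p.
Proof.
apply/polyP => i; rewrite coefD !coefZ !coef_map_id0 ?raddf0 // coefZ.
exact: lderiv_lmonM.
Qed.

(* x^r (x^m p) = x^(r+m) p *)
Lemma dx_lmonZ r c m p : dx r (lmon c m *: p) = lmon c m *: dx (r + m%:~R) p.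
Proof.
rewrite /dx map_lderiv_lmonZ derivZ !scalerDr !scalerA !lmonM.
have -> : lmon (c * (r + m%:~R)) (m - 1) =
    lmon (r * c) (m - 1) + lmon (c * m%:~R) (m - 1).
  by apply: laurentP => j /=; case: ifP; rewrite ?addr0 // mulrDr [r * c]mulrC.
rewrite scalerDl -!addrA [-1 + m]addrC mulr1 mul1r; congr (_ + _).
by rewrite addrCA.
Qed.

(** The coefficients of [dx r] do not involve log x; this is what makes the solutions stable under
    d/d(log x). *)
Lemma deriv_dx r p : (dx r p)^`() = dx r p^`().
Proof.
rewrite /dx !derivD !derivZ; congr (_ + _ + _).
apply/polyP => i; rewrite coef_deriv !coef_map_id0 ?raddf0 // coef_deriv.
by rewrite raddfMn.
Qed.

Fact theta_zmod_morphism r : zmod_morphism (theta r).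
Proof. by move=> p q; rewrite /theta raddfB scalerBr. Qed.
HB.instance Definition _ r := GRing.isZmodMorphism.Build
  (logpoly K) (logpoly K) (theta r) (theta_zmod_morphism r).

Section OpAct.
Variable D : {additive logpoly K -> logpoly K}.

Fact iter_zmod_morphism m : zmod_morphism (iter m D).
Proof. by move=> p q; elim: m => //= m ->; rewrite raddfB. Qed.
HB.instance Definition _ m := GRing.isZmodMorphism.Build
  (logpoly K) (logpoly K) (iter m D) (iter_zmod_morphism m).

Fact op_act_zmod_morphism (u : {poly laurent K}) : zmod_morphism (op_act D u).
Proof.
move=> p q; rewrite /op_act -sumrB; apply: eq_bigr => m _.
by rewrite raddfB scalerBr.
Qed.
HB.instance Definition _ u := GRing.isZmodMorphism.Build
  (logpoly K) (logpoly K) (op_act D u) (op_act_zmod_morphism u).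

Lemma op_act_widen n (u : {poly laurent K}) p : (size u <= n)%N ->
  op_act D u p = \sum_(m < n) u`_m *: iter m D p.
Proof.
move=> le; rewrite /op_act (big_ord_widen n (fun m => u`_m *: iter m D p)) //.
rewrite big_mkcond; apply: eq_bigr => m _; case: ltnP => // ltm.
by rewrite nth_default ?scale0r.
Qed.

Lemma op_actBl (u v : {poly laurent K}) p :
  op_act D (u - v) p = op_act D u p - op_act D v p.
Proof.
pose n := maxn (size u) (size v).
rewrite !(@op_act_widen n) ?leq_maxl ?leq_maxr //; last first.
  by rewrite (leq_trans (size_polyD _ _)) // size_polyN.
by rewrite -sumrB; apply: eq_bigr => m _; rewrite coefB scalerBl.
Qed.

Lemma op_actMX (u : {poly laurent K}) p :
  op_act D (u * 'X) p = op_act D u (D p).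
Proof.
rewrite (@op_act_widen (size u).+1); last first.
  by apply: (leq_trans (size_polyMleq _ _)); rewrite size_polyX addn2.
rewrite big_ord_recl coefMX scale0r add0r; apply: eq_bigr => m _.
by rewrite coefMX -iterSr.
Qed.

End OpAct.

Lemma op_act_morph (D D' : logpoly K -> logpoly K)
    (T : {linear logpoly K -> logpoly K}) u p :
  (forall q, T (D q) = D' (T q)) -> T (op_act D u p) = op_act D' u (T p).
Proof.
move=> TD; rewrite linear_sum; apply: eq_bigr => m _.
rewrite linearZ /=; congr (_ *: _).
by elim: (nat_of_ord m) => //= n <-; rewrite TD.
Qed.

Lemma theta_morph r r' (T : {linear logpoly K -> logpoly K}) p :
  (forall q, T (dx r q) = dx r' (T q)) -> T (theta r p) = theta r' (T p).
Proof. by move=> TD; rewrite linearZ TD. Qed.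

(** Transport of the equation along a K((x))-linear map. With T = d/d(log x) and r' = r it makes the
    solutions stable under that derivation; with T the multiplication by x^m it carries the exponent
    r + m to r. *)
Lemma PQ_morph (P : {poly K}) Q r r' (T : {linear logpoly K -> logpoly K})
    (f : logser K) :
    (forall q, T (dx r q) = dx r' (T q)) ->
  PQ P Q r' (fps_map T f) = fps_map T (PQ P Q r f).
Proof.
move=> TD; apply: fpsP => n /=; rewrite linearD /=; congr (_ + _).
  by apply/esym/op_act_morph => q; apply: theta_morph.
by rewrite linear_sum; apply: eq_bigr => i _; apply/esym/op_act_morph.
Qed.

Lemma dx_lconstZ r c p : dx r (lconst c *: p) = lconst c *: dx r p.
Proof. by rewrite dx_lmonZ addr0. Qed.

Lemma theta_lconstZ r c p : theta r (lconst c *: p) = lconst c *: theta r p.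
Proof. by rewrite /theta dx_lconstZ !scalerA mulrC. Qed.

Lemma op_act_lconstZ r c u p :
  op_act (dx r) u (lconst c *: p) = lconst c *: op_act (dx r) u p.
Proof.
by apply/esym/(op_act_morph (T := *:%R (lconst c))) => q; rewrite /= dx_lconstZ.
Qed.

Lemma op_act_theta_lconstZ r c u p :
  op_act (theta r) u (lconst c *: p) = lconst c *: op_act (theta r) u p.
Proof.
apply/esym/(op_act_morph (T := *:%R (lconst c))) => q.
by rewrite /= theta_lconstZ.
Qed.

(** Peels one linear factor off P; the constant z moves inside the operator because [theta] is
    linear over constants. *)
Lemma op_act_theta_XsubC r (P : {poly K}) z p :
  op_act (theta r) (map_poly (@lconst K) (P * ('X - z%:P))) p =
  op_act (theta r) (map_poly (@lconst K) P) (theta r p - lconst z *: p).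
Proof.
rewrite mulrBr rmorphB !rmorphM /= map_polyX map_polyC /= op_actBl op_actMX.
rewrite raddfB; congr (_ - _); rewrite /= op_act_theta_lconstZ.
rewrite [X in op_act _ X]mulrC mul_polyC.
rewrite (@op_act_widen _ (size (map_poly (@lconst K) P))) ?size_scale_leq //.
by rewrite /op_act scaler_sumr; apply: eq_bigr => m _; rewrite coefZ scalerA.
Qed.

(** The x^j component, a polynomial in log x. Euler operators act on these components separately,
    which turns questions about [theta] into questions about K[log x]. *)
Definition xcoef (j : int) p : {poly K} :=
  map_poly (fun f : laurent K => f j) p.

Lemma coef_xcoef j p m : (xcoef j p)`_m = p`_m j.
Proof. by rewrite coef_map_id0. Qed.

Lemma size_xcoef j p : (size (xcoef j p) <= size p)%N.
Proof. exact: size_poly. Qed.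

Lemma xcoefP p q : (forall j, xcoef j p = xcoef j q) -> p = q.
Proof.
move=> pq; apply/polyP => m; apply: laurentP => j.
by rewrite -!coef_xcoef pq.
Qed.

Lemma xcoef0 j : xcoef j 0 = 0.
Proof. by apply/polyP => m; rewrite coef_xcoef !coef0. Qed.

Lemma xcoef_bounded p : exists N, forall j, j < N -> xcoef j p = 0.
Proof.
pose lb (m : nat) := absz (lbound p`_m).
exists (- (\max_(m < size p) lb m)%:Z) => j ltj.
apply/polyP => m; rewrite coef_xcoef coef0.
have [ltm|lem] := ltnP m (size p); last by rewrite nth_default.
have le : (absz (lbound (p`_m)%R) <= \max_(i < size p) lb i)%N.
  exact: (@leq_bigmax _ (fun i : 'I_(size p) => lb i) (Ordinal ltm)).
apply: (@lboundP _ p`_m); move: le ltj.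
by move: (\max_(i < size p) lb i) (lbound p`_m) => M b; lia.
Qed.

Lemma xcoef_theta r z j p : xcoef j (theta r p - lconst z *: p) =
  (r + j%:~R - z) *: xcoef j p + (xcoef j p)^`().
Proof.
apply/polyP => m; rewrite coef_xcoef coefB /theta !coefZ.
rewrite coef_laurentD coef_laurentN.
rewrite coef_lconstM coef_lmonM mul1r /dx !coefD !coefZ coef_map_id0 ?raddf0 //.
rewrite !coef_laurentD !coef_lmonM coef_lderiv !coef_deriv mul1r.
rewrite coef_laurentMn !coef_xcoef.
by rewrite opprK subrK; ring.
Qed.

End LogPoly.

(** * Kernel and surjectivity of the Euler operator P *)

Section EulerOperator.
Variable K : fieldType.
Hypothesis char0 : [pchar K] =i pred0.

Lemma size_deriv_char0 (q : {poly K}) : size q^`() = (size q).-1.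
Proof.
case sz : (size q) => [|[|n]] /=.
- by move/eqP: sz; rewrite size_poly_eq0 => /eqP->; rewrite deriv0 size_poly0.
- by have /size1_polyC-> : (size q <= 1)%N; rewrite ?sz // derivC size_poly0.
have q0 : q != 0 by rewrite -size_poly_eq0 sz.
apply/eqP; rewrite eqn_leq -ltnS -sz lt_size_deriv //.
rewrite /= ltnNge; apply/negP => /leq_sizeP/(_ n (leqnn n))/eqP.
rewrite coef_deriv -mulr_natr mulf_eq0 (negPf (natr_neq0 char0 _)) orbF.
by have := lead_coef_eq0 q; rewrite lead_coefE sz /= => ->; rewrite (negPf q0).
Qed.

(** For c <> 0 the leading term survives; for c = 0 the derivative lowers the size by one in
    characteristic zero. Truncated subtraction covers q = 0. *)
Lemma size_scale_deriv (c : K) (q : {poly K}) :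
  size (c *: q + q^`()) = (size q - (c == 0%R))%N.
Proof.
have [->|c0] := eqVneq c 0.
  by rewrite scale0r add0r size_deriv_char0 subn1.
have [->|q0] := eqVneq q 0; first by rewrite deriv0 scaler0 addr0 size_poly0.
by rewrite subn0 size_polyDl size_scale // lt_size_deriv.
Qed.

(** For c = 0 this is integration. For c <> 0, if p1 solves the equation with right-hand side q',
    then (q - p1) / c solves it for q. *)
Lemma scale_deriv_surj (c : K) (q : {poly K}) : exists p : {poly K},
  [/\ c *: p + p^`() = q, (size p <= (size q).+1)%N & q = 0 -> p = 0].
Proof.
have [->|c0] := eqVneq c 0.
  (* At i = 0 the division by zero returns 0: the constant of integration is zero. *)
  exists (\poly_(i < (size q).+1) (q`_i.-1 / i%:R)); split.
  - rewrite scale0r add0r; apply/polyP => i.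
    rewrite coef_deriv coef_poly ltnS /=.
    have [lti|lei] := ltnP; last by rewrite mul0rn nth_default.
    by rewrite -[LHS]mulr_natr divfK ?natr_neq0.
  - exact: size_poly.
  - move=> ->; apply/polyP => i; rewrite size_poly0 coef_poly !coef0 mul0r.
    by case: ifP.
have [n] := ubnP (size q); elim: n q => // n IH q; rewrite ltnS => sq.
have [->|q0] := eqVneq q 0.
  by exists 0; rewrite scaler0 deriv0 addr0 size_poly0.
have [p1 [p1E sp1 _]] := IH q^`() (leq_trans (lt_size_deriv q0) sq).
exists (c^-1 *: (q - p1)); split=> [||q0']; last by rewrite q0' eqxx in q0.
  rewrite scalerA divff // scale1r derivZ derivB -p1E addrK scalerA mulVf //.
  by rewrite scale1r subrK.
apply: (leq_trans (size_scale_leq _ _)); apply: (leq_trans (size_polyD _ _)).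
rewrite size_polyN geq_max leqnSn /=; apply: (leq_trans sp1).
by rewrite ltnS size_deriv_char0 leq_pred.
Qed.

Implicit Types (p q : logpoly K) (r z : K) (zs : seq K).

Lemma theta_sub_surj r z q : exists p, theta r p - lconst z *: p = q.
Proof.
have /choice[s sP] := fun j : int =>
  scale_deriv_surj (r + j%:~R - z) (xcoef j q).
(* Reassembling the components into an element of K((x))[log x] requires a lower bound in x, which
   comes from p being 0 when q is, and a common degree in log x, which comes from the size bound. *)
have bnd m : exists N : int, forall j, j < N -> (s j)`_m = 0.
  have [N HN] := xcoef_bounded q; exists N => j /HN q0.
  by have [_ _ ->] := sP j; rewrite ?coef0.
exists (\poly_(m < (size q).+1) Laurent (bnd m)).
apply: xcoefP => j; rewrite xcoef_theta.
have -> : xcoef j (\poly_(m < (size q).+1) Laurent (bnd m)) = s j.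
  apply/polyP => m; rewrite coef_xcoef coef_poly; case: ltnP => // lem.
  rewrite nth_default //; have [_ le _] := sP j.
  by apply: (leq_trans le); apply: leq_ltn_trans lem; rewrite ?ltnS ?size_xcoef.
by have [] := sP j.
Qed.

(** P enters through the list of its roots, so that proofs go by induction on the factors and
    multiplicities are values of [count_mem]. *)
Definition euler_op r zs p :=
  op_act (theta r) (map_poly (@lconst K) (\prod_(z <- zs) ('X - z%:P))) p.

Lemma euler_op_nil r p : euler_op r [::] p = p.
Proof.
rewrite /euler_op big_nil rmorph1 /op_act size_poly1 big_ord1.
by rewrite coefC /= scale1r.
Qed.

Lemma euler_op_cons r z zs p :
  euler_op r (z :: zs) p = euler_op r zs (theta r p - lconst z *: p).
Proof. by rewrite /euler_op big_cons mulrC op_act_theta_XsubC. Qed.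

Lemma euler_op_surj r zs q : exists p, euler_op r zs p = q.
Proof.
elim: zs q => [|z zs IH] q; first by exists q; rewrite euler_op_nil.
have [p' <-] := IH q; have [p <-] := theta_sub_surj r z p'.
by exists p; rewrite euler_op_cons.
Qed.

(** Each factor with root r + j lowers the degree of the x^j component by one, and every other
    factor preserves it. *)
Lemma size_xcoef_euler_op r zs j p : size (xcoef j (euler_op r zs p)) =
  (size (xcoef j p) - count_mem (r + j%:~R)%R zs)%N.
Proof.
elim: zs p => [|z zs IH] p; first by rewrite euler_op_nil subn0.
rewrite euler_op_cons IH xcoef_theta size_scale_deriv subnDA /=.
by rewrite subr_eq0 [z == _]eq_sym.
Qed.

Lemma euler_op_eq0 r zs p : euler_op r zs p = 0 <->
  forall j, (size (xcoef j p) <= count_mem (r + j%:~R)%R zs)%N.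
Proof.
split=> [p0 j|le].
  by rewrite -subn_eq0 -size_xcoef_euler_op p0 xcoef0 size_poly0.
apply: xcoefP => j; rewrite xcoef0; apply/eqP.
by rewrite -size_poly_eq0 size_xcoef_euler_op subn_eq0.
Qed.

End EulerOperator.

(** * Solving the equation order by order in t *)

Section LogSer.
Variable K : comNzRingType.
Implicit Types (f g : logser K) (c : fps K).

Fact scalar_fps_zmod_morphism : zmod_morphism (@scalar_fps K).
Proof. by move=> c d; apply: fpsP => n /=; rewrite !rmorphB. Qed.
HB.instance Definition _ := GRing.isZmodMorphism.Build
  (fps K) (logser K) (@scalar_fps K) scalar_fps_zmod_morphism.

Fact scalar_fps_monoid_morphism : monoid_morphism (@scalar_fps K).
Proof. by have := @fps_map_monoid_morphism _ _ (polyC \o @lconst K). Qed.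
HB.instance Definition _ := GRing.isMonoidMorphism.Build
  (fps K) (logser K) (@scalar_fps K) scalar_fps_monoid_morphism.

Lemma coef_scalar_fpsM c f n :
  (scalar_fps c * f) n = \sum_(i < n.+1) lconst (c i) *: f (n - i)%N.
Proof. by rewrite coef_fpsM; apply: eq_bigr => i _; rewrite -mul_polyC. Qed.

Lemma triangular_exchange (V : nmodType) n (G : nat -> nat -> V) :
  \sum_(i < n.+1) \sum_(j < (n - i).+1) G i j =
  \sum_(j < n.+1) \sum_(i < (n - j).+1) G i j.
Proof.
transitivity (\sum_(i < n.+1) \sum_(j < n.+1 | (j <= n - i)%N) G i j).
  by apply: eq_bigr => i _; rewrite (big_ord_narrow_leq (leq_subr i n)).
rewrite (exchange_big_dep predT) //=; apply: eq_bigr => j _.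
transitivity (\sum_(i < n.+1 | (i <= n - j)%N) G i j).
  by apply: eq_bigl => i; have := ltn_ord i; have := ltn_ord j; lia.
by rewrite (big_ord_narrow_leq (leq_subr j n)).
Qed.

Variables (P : {poly K}) (Q : nat -> {poly laurent K}) (r : K).

(** Taking P as the term of order 0 in t turns [PQ] into a single Cauchy product. *)
Definition PQ_coef i : logpoly K -> logpoly K :=
  if i is 0 then op_act (theta r) (map_poly (@lconst K) P)
  else op_act (dx r) (Q i).

Lemma coef_PQ f n : PQ P Q r f n = \sum_(i < n.+1) PQ_coef i (f (n - i)%N).
Proof. by rewrite big_ord_recl /= subn0 big_add1 big_mkord. Qed.

Fact PQ_coef_zmod_morphism i : zmod_morphism (PQ_coef i).
Proof. by case: i => [|i] p q; exact: raddfB. Qed.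
HB.instance Definition _ i := GRing.isZmodMorphism.Build
  (logpoly K) (logpoly K) (PQ_coef i) (PQ_coef_zmod_morphism i).

Lemma PQ_coefZ i (a : K) p :
  PQ_coef i (lconst a *: p) = lconst a *: PQ_coef i p.
Proof.
by case: i => [|i]; rewrite /= (op_act_theta_lconstZ, op_act_lconstZ).
Qed.

Fact PQ_zmod_morphism : zmod_morphism (PQ P Q r).
Proof.
move=> f g; apply: fpsP => n; rewrite coef_fpsD coef_fpsN !coef_PQ -sumrB.
by apply: eq_bigr => i _; rewrite coef_fpsD coef_fpsN raddfB.
Qed.
HB.instance Definition _ := GRing.isZmodMorphism.Build
  (logser K) (logser K) (PQ P Q r) PQ_zmod_morphism.

Lemma PQ_scalarM c f : PQ P Q r (scalar_fps c * f) = scalar_fps c * PQ P Q r f.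
Proof.
apply: fpsP => n; rewrite coef_PQ coef_scalar_fpsM.
pose G i j := lconst (c j) *: PQ_coef i (f (n - i - j)%N).
transitivity (\sum_(i < n.+1) \sum_(j < (n - i).+1) G i j).
  apply: eq_bigr => i _; rewrite coef_scalar_fpsM raddf_sum.
  by apply: eq_bigr => j _; rewrite /= PQ_coefZ.
rewrite triangular_exchange; apply: eq_bigr => j _; rewrite coef_PQ scaler_sumr.
by apply: eq_bigr => i _; rewrite /G -!subnDA addnC.
Qed.

Lemma solution_sum n (c : 'I_n -> fps K) (b : 'I_n -> logser K) :
  (forall j, solution P Q r (b j)) ->
  solution P Q r (\sum_j scalar_fps (c j) * b j).
Proof.
rewrite /solution => bP; rewrite raddf_sum big1 // => j _.
by rewrite /= PQ_scalarM bP mulr0.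
Qed.

Lemma solution_lift p :
    (forall q, exists q', op_act (theta r) (map_poly (@lconst K) P) q' = q) ->
    op_act (theta r) (map_poly (@lconst K) P) p = 0 ->
  exists f, solution P Q r f /\ f 0%N = p.
Proof.
move=> /choice[T TP] p0.
(* [T] is a chosen right inverse of P; it cancels what Q contributes from the earlier
   coefficients. *)
pose step n (f : nat -> logpoly K) := if n is 0 then p else
  T (- \sum_(i < n) PQ_coef i.+1 (f (n - i.+1)%N)).
have [|f fE] := @course_of_values _ 0 step.
  move=> [|n] u v uv //=; congr (T (- _)); apply: eq_bigr => i _.
  by rewrite uv //; lia.
exists (Fps f); split; last by rewrite /= fE.
apply: fpsP => n; rewrite coef_PQ big_ord_recl /= subn0 fE.
by case: n => [|n] /=; rewrite ?big_ord0 ?addr0 // TP addNr.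
Qed.

(** Greedy expansion: [rest m c] is the t^m coefficient left after subtracting the combination with
    scalars truncated below t^m, and its coordinates in the constant terms of the b e give the next
    scalars. *)
Lemma solution_span n (b : 'I_n -> logser K) (coord : logpoly K -> 'I_n -> K) :
    (forall e, solution P Q r (b e)) ->
    (forall p, op_act (theta r) (map_poly (@lconst K) P) p = 0 ->
      p = \sum_e lconst (coord p e) *: b e 0%N) ->
  forall f, solution P Q r f ->
  exists c : 'I_n -> fps K, f = \sum_e scalar_fps (c e) * b e.
Proof.
move=> bP coordP f fP.
pose rest (m : nat) (c : nat -> 'I_n -> K) : logpoly K :=
  f m - \sum_e \sum_(i < m) lconst (c i e) *: b e (m - i)%N.
have [|c cE] := @course_of_values _ (fun=> 0)
    (fun m (c : nat -> 'I_n -> K) => coord (rest m c)).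
  move=> m u v uv; congr (coord (_ - _)); apply: eq_bigr => e _.
  by apply: eq_bigr => i _; rewrite uv.
pose C e := Fps (c ^~ e); exists C; apply/eqP; rewrite -subr_eq0; apply/eqP.
set g := f - _; have gP : solution P Q r g.
  by rewrite /solution raddfB /= fP solution_sum // subr0.
have gE m : g m = rest m c - \sum_e lconst (c m e) *: b e 0%N.
  rewrite /g coef_fpsD coef_fpsN coef_fps_sum /rest -addrA -opprD -big_split.
  congr (_ - _); apply: eq_bigr => e _.
  by rewrite coef_scalar_fpsM big_ord_recr /= subnn.
have bP0 e : PQ_coef 0 (b e 0%N) = 0.
  have := congr1 (fun h : logser K => h 0%N) (bP e).
  by rewrite coef_PQ big_ord1.
(* Once the lower coefficients of g vanish, (P + Q) g = 0 yields P g_m = 0. Hence [rest m c] lies in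
   the kernel of P too, where [coord] is exact. *)
apply: fpsP => m; elim/ltn_ind: m => m IH.
have gm : PQ_coef 0 (g m) = 0.
  have := congr1 (fun h : logser K => h m) gP.
  rewrite coef_PQ big_ord_recl subn0.
  rewrite big1 ?addr0 // => i _; rewrite IH ?raddf0 //.
  by rewrite /= /bump /=; have := ltn_ord i; lia.
rewrite gE cE -coordP ?subrr //.
rewrite -[RHS]gm gE [RHS]raddfB [X in _ - X]raddf_sum.
by rewrite big1 ?subr0 // => e _; rewrite [LHS]PQ_coefZ bP0 scaler0.
Qed.

End LogSer.

(** When the scalars vanish below t^m, the t^m coefficient of the relation is a relation between
    constant terms. *)
Lemma fps_free (K : comNzRingType) n (b : 'I_n -> logser K) :
    (forall c : 'I_n -> K,
      \sum_e lconst (c e) *: b e 0%N = 0 -> forall e, c e = 0) ->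
  forall c : 'I_n -> fps K, \sum_e scalar_fps (c e) * b e = 0 ->
  forall e, c e = 0.
Proof.
move=> free c c0; suff cm m e : c e m = 0 by move=> e; apply: fpsP.
elim/ltn_ind: m e => m IH; apply: free.
have := congr1 (fun h : logser K => h m) c0.
rewrite coef_fps_sum coef_fps0 => {2}<-; apply: eq_bigr => e _.
rewrite coef_scalar_fpsM big_ord_recr /= subnn big1 ?add0r //.
by move=> i _; rewrite IH // rmorph0 scale0r.
Qed.

(** * The derivation d/d(log x) and the series x^lam *)

Section LogDerivation.
Variable K : comNzRingType.
Implicit Types (f g : logser K) (c : fps K).

Definition dlog f : logser K := fps_map (@deriv _) f.

Fact dlog_zmod_morphism : zmod_morphism dlog.
Proof. by move=> f g; apply: fpsP => n /=; rewrite derivB. Qed.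
HB.instance Definition _ := GRing.isZmodMorphism.Build
  (logser K) (logser K) dlog dlog_zmod_morphism.

Lemma dlogM f g : dlog (f * g) = dlog f * g + f * dlog g.
Proof.
apply: fpsP => n; rewrite /= raddf_sum -big_split /=.
by apply: eq_bigr => i _; rewrite derivM.
Qed.

Lemma dlog_scalar c : dlog (scalar_fps c) = 0.
Proof. by apply: fpsP => n /=; rewrite derivC. Qed.

Lemma dlog_scalarM c f : dlog (scalar_fps c * f) = scalar_fps c * dlog f.
Proof. by rewrite dlogM dlog_scalar mul0r add0r. Qed.

Definition dlog_sub c f := dlog f - scalar_fps c * f.

Lemma dlog_solution (P : {poly K}) Q r f :
  solution P Q r f -> solution P Q r (dlog f).
Proof.
rewrite /solution /dlog => fP.
rewrite (@PQ_morph _ P Q r r (@deriv _)) ?fP; last first.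
  by move=> q; rewrite /= deriv_dx.
by apply: fpsP => n /=; rewrite deriv0.
Qed.

(** Here E plays the role of x^(-c): multiplication by E conjugates delta - c into delta. *)
Lemma dlog_conj E c f n : dlog E = - scalar_fps c * E ->
  iter n dlog (E * f) = E * iter n (dlog_sub c) f.
Proof.
move=> EE; elim: n => //= n ->; rewrite dlogM EE /dlog_sub; ring.
Qed.

End LogDerivation.

Section Exponential.
Variable K : fieldType.
Hypothesis char0 : [pchar K] =i pred0.
Implicit Types (f g : logser K) (lam : fps K).

Lemma pchar_laurent : [pchar laurent K] =i pred0.
Proof. by move=> p; rewrite (fmorph_pchar (@lconst K)) char0. Qed.

Lemma fps_expr_eq0 lam m n : lam 0%N = 0 -> (n < m)%N -> (lam ^+ m) n = 0.
Proof.
move=> lam0; elim: m n => // m IH n; rewrite ltnS => lenm.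
rewrite exprS coef_fpsM big_ord_recl lam0 mul0r add0r big1 // => i _.
by rewrite IH ?mulr0 //= /bump; have := ltn_ord i; lia.
Qed.

Lemma coef_xpow_fps lam n m : lam 0%N = 0 ->
  (xpow_fps lam n)`_m = lconst ((lam ^+ m) n / m`!%:R).
Proof.
move=> lam0; rewrite coef_poly; case: ltnP => // lt.
by rewrite fps_expr_eq0 // mul0r rmorph0.
Qed.

Lemma dlog_xpow_fps lam : lam 0%N = 0 ->
  dlog (xpow_fps lam) = scalar_fps lam * xpow_fps lam.
Proof.
move=> lam0; apply: fpsP => n; apply/polyP => m.
rewrite coef_deriv coef_xpow_fps // -[LHS](raddfMn (@lconst K)).
rewrite coef_scalar_fpsM coef_sum.
have -> : (lam ^+ m.+1) n / m.+1`!%:R *+ m.+1 = (lam ^+ m.+1) n / m`!%:R.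
  rewrite -[LHS]mulr_natr factS natrM invfM -!mulrA; congr (_ * _).
  by rewrite mulrCA mulVf ?mulr1 // natr_neq0.
rewrite exprS coef_fpsM mulr_suml raddf_sum; apply: eq_bigr => i _.
by rewrite coefZ coef_xpow_fps //= -rmorphM mulrA.
Qed.

Lemma dlog_eq0 f : dlog f = 0 -> fps_map (fun p => p.[0]) f = 1 -> f = 1.
Proof.
move=> f0 f1; apply: fpsP => n.
have sz : (size (f n) <= 1)%N.
  have := congr1 (fun h : logser K => size (h n)) f0.
  rewrite /= (size_deriv_char0 pchar_laurent) size_poly0.
  by case: (size _) => [|[]].
have : (f n).[0] = (1 : fps (laurent K)) n by rewrite -f1.
rewrite [f n](size1_polyC sz) hornerC => ->.
by rewrite -[RHS]/((n == 0)%N%:R) coef_fps1; case: (n == 0)%N.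
Qed.

(** No binomial expansion is needed: delta kills the product, which is therefore free of log x, and
    at log x = 0 both factors are 1. *)
Lemma xpow_fpsN lam : lam 0%N = 0 -> xpow_fps lam * xpow_fps (- lam) = 1.
Proof.
move=> lam0; have Nlam0 : (- lam) 0%N = 0 by rewrite coef_fpsN lam0 oppr0.
apply: dlog_eq0.
  rewrite dlogM !dlog_xpow_fps // rmorphN mulNr mulrN.
  by rewrite [_ * (_ * xpow_fps (- lam))]mulrCA mulrA subrr.
have eval1 (mu : fps K) :
    mu 0%N = 0 -> fps_map (horner_eval 0) (xpow_fps mu) = 1.
  move=> mu0; apply: fpsP => n.
  rewrite /= /horner_eval horner_coef0 coef_xpow_fps //.
  by rewrite expr0 divr1 coef_fps1 rmorph_nat.
by rewrite -[LHS]/(fps_map (horner_eval 0) _) rmorphM /= !eval1 // mulr1.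
Qed.

(** The bound n on the size in log x is the same for all coefficients of g; this uniformity allows
    the exchange of [log x] and [[t]]. *)
Lemma iter_dlog_eq0 n g : iter n (@dlog K) g = 0 ->
  exists G : {poly fps (laurent K)}, (size G <= n)%N /\ g = log_in G.
Proof.
move=> g0; have szI k m : size (iter m (@dlog K) g k) = (size (g k) - m)%N.
  elim: m => [|m IH]; first by rewrite subn0.
  by rewrite /= (size_deriv_char0 pchar_laurent) IH subnS.
have sz k : (size (g k) <= n)%N by rewrite -subn_eq0 -szI g0 size_poly0.
exists (\poly_(m < n) Fps (fun k => (g k)`_m)); split; first exact: size_poly.
apply: fpsP => k; apply/polyP => m; set G := \poly_(i < n) _.
have GE : G`_m k = (g k)`_m.
  rewrite coef_poly; case: ltnP => // le; rewrite nth_default //.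
  exact: leq_trans le.
rewrite /= coef_poly GE; case: ltnP => // le.
by rewrite -GE nth_default.
Qed.

(** The lowest nonzero coefficient p of f would satisfy p' = lam(0) p, impossible for degree
    reasons. *)
Lemma dlog_sub_inj lam f : lam 0%N != 0 -> dlog_sub lam f = 0 -> f = 0.
Proof.
move=> lam0 fE; apply: fpsP => n; elim/ltn_ind: n => n IH; apply/eqP.
apply: contraT => fn0.
have : (f n)^`() = lconst (lam 0%N) *: f n.
  have := congr1 (fun h : logser K => h n) fE.
  rewrite coef_fpsD coef_fpsN coef_scalar_fpsM big_ord_recl subn0 big1 ?addr0.
    by move/eqP; rewrite subr_eq0 => /eqP.
  by move=> i _; rewrite IH ?scaler0 //= /bump; have := ltn_ord i; lia.
move/(congr1 (fun p : logpoly K => size p)); rewrite size_scale ?fmorph_eq0 //.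
by move=> sz; have := lt_size_deriv fn0; rewrite sz ltnn.
Qed.

Lemma iter_dlog_sub_inj lam n f :
  lam 0%N != 0 -> iter n (dlog_sub lam) f = 0 -> f = 0.
Proof. by move=> lam0; elim: n => //= n IH /(dlog_sub_inj lam0)/IH. Qed.

Lemma generalized_eigenvector_xpow lam n f :
    lam 0%N = 0 -> iter n (dlog_sub lam) f = 0 ->
  exists g : {poly fps (laurent K)},
    (size g <= n)%N /\ f = xpow_fps lam * log_in g.
Proof.
move=> lam0 f0; have Nlam0 : (- lam) 0%N = 0 by rewrite coef_fpsN lam0 oppr0.
have [|g [sg gE]] := @iter_dlog_eq0 n (xpow_fps (- lam) * f).
  by rewrite (dlog_conj (c := lam)) ?f0 ?mulr0 // dlog_xpow_fps // rmorphN.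
by exists g; split=> //; rewrite -gE mulrA xpow_fpsN // mul1r.
Qed.

End Exponential.

(** * Bases of the solution module *)

Section LogMonomials.
Variable K : comNzRingType.

(* x^j (log x)^q, with m = (j, q) *)
Definition logmon (m : nat * nat) : logpoly K := lmon 1 (m.1)%:Z *: 'X^(m.2).

Lemma coef_sum_logmon n (c : 'I_n -> K) (m : 'I_n -> nat * nat) q (j : int) :
  (\sum_e lconst (c e) *: logmon (m e))`_q j =
  \sum_e c e * ((j == (m e).1) && (q == (m e).2))%:R.
Proof.
rewrite coef_sum coef_laurent_sum; apply: eq_bigr => e _.
rewrite /logmon !coefZ coefXn coef_lconstM mulr_natr coef_laurentMn /=.
by congr (_ * _); case: (q == _); case: (j == _).
Qed.

Lemma coef_sum_logmon_inj n (c : 'I_n -> K) (m : 'I_n -> nat * nat) e :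
    injective m ->
  (\sum_e lconst (c e) *: logmon (m e))`_(m e).2 (m e).1 = c e.
Proof.
move=> m_inj; rewrite coef_sum_logmon (bigD1 e) //= !eqxx mulr1.
rewrite big1 ?addr0 // => e' ne; rewrite (_ : _ && _ = false) ?mulr0 //.
apply: contraNF ne => /andP[/eqP[E1] /eqP E2].
by apply/eqP/m_inj; move: (m e) (m e') E1 E2 => [? ?] [? ?] /= -> ->.
Qed.

Lemma logmon_free n (m : 'I_n -> nat * nat) (c : 'I_n -> K) : injective m ->
  \sum_e lconst (c e) *: logmon (m e) = 0 -> forall e, c e = 0.
Proof.
by move=> m_inj c0 e; rewrite -(coef_sum_logmon_inj c e m_inj) c0 coef0.
Qed.

End LogMonomials.

Lemma map_logmon (K F : comNzRingType) (h : {rmorphism K -> F}) m :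
  map_poly (laurent_map h) (logmon K m) = logmon F m.
Proof. by rewrite /logmon map_polyZ map_polyXn /= laurent_map_lmon rmorph1. Qed.

(** Numbers the kernel monomials x^j (log x)^q, q < a_j, by the index type that the theorem imposes
    on the basis. *)
Lemma enum_exponents (a : seq nat) :
  exists m : 'I_(\sum_(j < size a) nth 0%N a j) -> nat * nat,
    injective m /\ forall j q, (q < nth 0%N a j)%N <-> exists e, m e = (j, q).
Proof.
pose ms := [seq (j, q) | j <- iota 0 (size a), q <- iota 0 (nth 0%N a j)].
have sz : size ms = (\sum_(j < size a) nth 0%N a j)%N.
  rewrite size_allpairs_dep sumnE big_map -{1}[size a]subn0 -/(index_iota _ _).
  by rewrite big_mkord; apply: eq_bigr => j _; rewrite size_iota.
have uq : uniq ms.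
  apply: allpairs_uniq_dep => [|j _|]; rewrite ?iota_uniq //.
  by move=> [j q] [j' q'] _ _ /= [-> ->].
exists (fun e => nth (0, 0)%N ms e); split=> [e e' /eqP|j q].
  by rewrite nth_uniq ?sz // => /eqP/val_inj.
have mem : ((j, q) \in ms) = (q < nth 0%N a j)%N.
  apply/allpairsPdep/idP => [[j' [q' [_ + [-> ->]]]]|lt].
    by rewrite mem_iota.
  exists j, q; rewrite !mem_iota /= !add0n; split=> //.
  by rewrite ltnNge; apply: contraTN lt => le; rewrite nth_default.
rewrite -mem; split=> [jq|[e <-]]; last by rewrite mem_nth ?sz.
have lt : (index (j, q) ms < \sum_(j < size a) nth 0%N a j)%N.
  by rewrite -sz index_mem.
by exists (Ordinal lt); rewrite /= nth_index.
Qed.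

Section SolutionBasis.
Variable K : fieldType.
Hypothesis char0 : [pchar K] =i pred0.
Variables (zs : seq K) (Q : nat -> {poly laurent K}) (r : K) (a : seq nat).
Let P := \prod_(z <- zs) ('X - z%:P).
(** No root of P has the form r + j with j < 0, so the kernel monomials involve only x^j with j >=
    0. *)
Hypothesis countE : forall j : int, count_mem (r + j%:~R) zs =
  if j is Posz m then nth 0%N a m else 0%N.
Variables (n : nat) (m : 'I_n -> nat * nat).
Hypothesis m_inj : injective m.
Hypothesis mE : forall j q, (q < nth 0%N a j)%N <-> exists e, m e = (j, q).

Lemma logmon_ker e : euler_op r zs (logmon K (m e)) = 0.
Proof.
apply/(euler_op_eq0 char0) => j; apply/leq_sizeP => q leq.
rewrite coef_xcoef /logmon coefZ coefXn mulr_natr coef_laurentMn /=.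
case: eqP => [jE|_]; last by rewrite mul0rn.
case: eqP => [qE|//]; have : (q < nth 0%N a (m e).1)%N.
  by apply/mE; exists e; rewrite qE; case: (m e).
by move: leq; rewrite countE jE ltnNge => ->.
Qed.

Lemma ker_logmon p : euler_op r zs p = 0 ->
  p = \sum_e lconst (p`_(m e).2 (m e).1) *: logmon K (m e).
Proof.
move/(euler_op_eq0 char0) => pP; apply/polyP => q; apply: laurentP => j.
have [[e [-> ->]]|nex] := pselect (exists e, j = (m e).1 /\ q = (m e).2).
  by rewrite coef_sum_logmon_inj.
rewrite coef_sum_logmon big1 => [|e _]; last first.
  rewrite (_ : _ && _ = false) ?mulr0 //; apply/negP => /andP[/eqP ? /eqP ?].
  by case: nex; exists e.
rewrite -coef_xcoef nth_default //; apply: (leq_trans (pP j)); rewrite countE.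
case: j nex => [j|//] nex; rewrite leqNgt; apply/negP => /mE[e E].
by apply: nex; exists e; rewrite E.
Qed.

Lemma solution_basis : exists b : 'I_n -> logser K,
  [/\ forall e, solution P Q r (b e), forall e, b e 0%N = logmon K (m e)
    & is_basis (@scalar_fps K) (solution P Q r) b].
Proof.
have /choice[b bP] : forall e, exists f,
    solution P Q r f /\ f 0%N = logmon K (m e).
  move=> e; apply: solution_lift; last exact: logmon_ker.
  by move=> q; apply: (euler_op_surj char0).
have b0 e : b e 0%N = logmon K (m e) by have [] := bP e.
have bS e : solution P Q r (b e) by have [] := bP e.
exists b; split=> //; split=> [f|c]; last first.
  apply: fps_free => {}c; under eq_bigr do rewrite b0.
  exact: logmon_free.
split=> [|[c ->]]; last exact: solution_sum.
apply: (solution_span (coord := fun p e => p`_(m e).2 (m e).1)) => // p p0.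
by under eq_bigr do rewrite b0; apply: ker_logmon.
Qed.

End SolutionBasis.

(** * Extension of scalars to Laurent series in a root of t *)

Section ScalarLaurent.
Variable K : comNzRingType.

(** [scalar_laurent] is built on an additive map; reading it through a ring morphism gives its
    multiplicativity. *)
Lemma scalar_laurentE (c : laurent K) :
  scalar_laurent c =
  laurent_map (polyC \o @lconst K : {rmorphism K -> logpoly K}) c.
Proof. exact: laurentP. Qed.

Fact scalar_laurent_zmod_morphism : zmod_morphism (@scalar_laurent K).
Proof. by move=> c d; rewrite !scalar_laurentE rmorphB. Qed.
HB.instance Definition _ := GRing.isZmodMorphism.Build
  (laurent K) (laurent (logpoly K)) (@scalar_laurent K)
  scalar_laurent_zmod_morphism.

Fact scalar_laurent_monoid_morphism : monoid_morphism (@scalar_laurent K).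
Proof.
by split=> [|c d]; rewrite !scalar_laurentE (rmorph1, rmorphM).
Qed.
HB.instance Definition _ := GRing.isMonoidMorphism.Build
  (laurent K) (laurent (logpoly K)) (@scalar_laurent K)
  scalar_laurent_monoid_morphism.

Lemma scalar_laurent_fps (c : fps K) :
  scalar_laurent (laurent_fps c) = laurent_fps (scalar_fps c).
Proof. by rewrite scalar_laurentE [LHS]laurent_map_of_fps. Qed.

End ScalarLaurent.

Lemma is_basis_change (F : fieldType) (B : comNzRingType)
    (phi : {rmorphism F -> B}) (S : B -> Prop) n (W : 'M[F]_n)
    (b b' : 'I_n -> B) :
    W \in unitmx -> (forall j, b' j = \sum_k phi (W j k) * b k) ->
  is_basis phi S b -> is_basis phi S b'.
Proof.
move=> Wu b'E [span free].
have comb (c : 'rV_n) :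
    \sum_j phi (c 0 j) * b' j = \sum_k phi ((c *m W) 0 k) * b k.
  under eq_bigr do rewrite b'E mulr_sumr.
  rewrite exchange_big; apply: eq_bigr => k _.
  rewrite mxE rmorph_sum mulr_suml; apply: eq_bigr => j _.
  by rewrite rmorphM mulrA.
have row c : \sum_j phi (c j) * b' j = \sum_j phi ((\row_j c j) 0 j) * b' j.
  by apply: eq_bigr => j _; rewrite mxE.
split=> [f|c]; last first.
  rewrite row comb => /free c0 j.
  have: (\row_j c j) *m W = 0 by apply/rowP => k; rewrite c0 mxE.
  move/(congr1 (mulmx^~ (invmx W))); rewrite mulmxK // mul0mx => /rowP/(_ j).
  by rewrite !mxE.
rewrite span; split=> [[c ->]|[c ->]]; last first.
  by rewrite row comb; exists (fun k => ((\row_j c j) *m W) 0 k).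
exists (fun j => ((\row_k c k) *m invmx W) 0 j).
by rewrite comb mulmxKV //; apply: eq_bigr => k _; rewrite mxE.
Qed.

Section PuiseuxEmbedding.
Variables (K F : fieldType) (iota : {rmorphism K -> F}) (L : nat).

(** These substitutions stay among power series in u, where [dlog] is defined; [puiseux_in] follows
    the second one by the inclusion into Laurent series. *)
Definition puiseux_scalar (c : fps K) : fps F := ramify L.+1 (fps_map iota c).
Definition puiseux_ser (f : logser K) : logser F :=
  ramify L.+1 (fps_map (map_poly (laurent_map iota)) f).

HB.instance Definition _ := GRing.RMorphism.copy puiseux_scalar
  (ramify L.+1 \o fps_map iota).
HB.instance Definition _ := GRing.RMorphism.copy puiseux_ser
  (ramify L.+1 \o fps_map (map_poly (laurent_map iota))).

Lemma puiseux_ser_scalar c :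
  puiseux_ser (scalar_fps c) = scalar_fps (puiseux_scalar c).
Proof.
apply: fpsP => n /=; case: ifP => _; last by rewrite rmorph0.
by rewrite map_polyC /= laurent_map_lmon.
Qed.

Lemma dlog_puiseux_ser f : dlog (puiseux_ser f) = puiseux_ser (dlog f).
Proof.
apply: fpsP => n /=; case: ifP => _; last by rewrite deriv0.
by rewrite deriv_map.
Qed.

End PuiseuxEmbedding.

Section Combination.
Variables (F : comNzRingType) (n : nat).
Variables (e : 'I_n.+1 -> logser F) (A : 'M[fps F]_n.+1).
Hypothesis dlog_e : forall j, dlog (e j) = \sum_k scalar_fps (A j k) * e k.

Definition fps_comb (w : 'rV[fps F]_n.+1) : logser F :=
  \sum_k scalar_fps (w 0 k) * e k.

(** Scalars are killed by delta, so delta acts on rows of coordinates as right multiplication by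
    A. *)
Lemma dlog_sub_comb lam w :
  dlog_sub lam (fps_comb w) = fps_comb (w *m (A - lam%:M)).
Proof.
rewrite /dlog_sub mulmxBr mul_mx_scalar /fps_comb raddf_sum mulr_sumr.
under [RHS]eq_bigr do rewrite !mxE rmorphB mulrBl.
rewrite [RHS]sumrB; congr (_ - _); last first.
  by apply: eq_bigr => k _; rewrite rmorphM mulrA.
under eq_bigr do rewrite /= dlog_scalarM dlog_e mulr_sumr.
rewrite exchange_big; apply: eq_bigr => k _; rewrite rmorph_sum mulr_suml.
by apply: eq_bigr => j _; rewrite rmorphM mulrA.
Qed.

Lemma iter_dlog_sub_comb lam m w :
  iter m (dlog_sub lam) (fps_comb w) = fps_comb (w *m (A - lam%:M) ^+ m).
Proof.
elim: m => [|m IH]; first by rewrite expr0 mulmx1.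
by rewrite iterS IH dlog_sub_comb exprSr -mulmxA.
Qed.

End Combination.

(** A relation over F((u)) becomes one over F[[u]] after multiplication by a power of u. Generation
    follows by expanding each solution in b, since scalars of K[[t]] are sent to scalars of
    F[[u]]. *)
Lemma puiseux_span_basis (K F : fieldType) (iota : {rmorphism K -> F}) L n
    (S : logser K -> Prop) (b : 'I_n -> logser K) :
    is_basis (@scalar_fps K) S b ->
    (forall c : 'I_n -> fps F,
      \sum_k scalar_fps (c k) * puiseux_ser iota L (b k) = 0 ->
      forall k, c k = 0) ->
  is_basis (@scalar_laurent F)
    (span_image (@scalar_laurent F) (puiseux_in iota L.+1) S)
    (fun k => laurent_fps (puiseux_ser iota L (b k))).
Proof.
move=> [span _] free; split=> [h|c c0 k]; last first.
  have [N [w cE]] := laurent_clear_denom (\row_k c k).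
  have cE' j : c j = lmon 1 N * laurent_fps (w 0 j).
    by have := congr1 (fun M : 'rV_n => M 0 j) cE; rewrite !mxE.
  rewrite cE' (free (fun j => w 0 j)) ?rmorph0 ?mulr0 //.
  apply: laurent_fps_inj; rewrite rmorph0.
  have := congr1 ( *%R (scalar_laurent (lmon 1 (- N)))) c0.
rewrite mulr0 mulr_sumr => sum0; rewrite rmorph_sum -[RHS]sum0.
apply: eq_bigr => j _.
rewrite mulrA cE' -rmorphM mulrA lmonM addNr mulr1 lmon1 mul1r /=.
  by rewrite scalar_laurent_fps rmorphM.
split=> [[m [c [f [fS ->]]]]|[c ->]]; last first.
  exists n, c, b; split=> // j; apply/span; exists (fun k => (k == j)%:R).
  rewrite (bigD1 j) //= eqxx rmorph1 mul1r big1 ?addr0 // => k /negPf->.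
  by rewrite rmorph0 mul0r.
have /choice[d dE] : forall j, exists d : 'I_n -> fps K,
    f j = \sum_k scalar_fps (d k) * b k by move=> j; apply/span.
exists (fun k => \sum_j c j * laurent_fps (puiseux_scalar iota L (d j k))).
under [RHS]eq_bigr do rewrite rmorph_sum mulr_suml.
rewrite exchange_big; apply: eq_bigr => j _ /=.
rewrite -[puiseux_in _ _ _]/(laurent_fps (puiseux_ser iota L (f j))) dE.
rewrite !rmorph_sum mulr_sumr; apply: eq_bigr => k _.
by rewrite !rmorphM /= puiseux_ser_scalar scalar_laurent_fps mulrA.
Qed.

Theorem puiseux_basis (K : fieldType) (char0 : [pchar K] =i pred0) P Q (r : K) n
    (b : 'I_n -> logser K) (m : 'I_n -> nat * nat) :
    (0 < n)%N -> injective m -> (forall e, b e 0%N = logmon K (m e)) ->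
    is_basis (@scalar_fps K) (solution P Q r) b ->
  forall (F : closedFieldType) (iota : {rmorphism K -> F}),
  exists L (lam : 'I_n -> fps F) (g : 'I_n -> {poly fps (laurent F)}),
  [/\ (0 < L)%N, forall j, lam j 0%N = 0, forall j, (size (g j) <= n)%N
    & is_basis (@scalar_laurent F)
      (span_image (@scalar_laurent F) (puiseux_in iota L) (solution P Q r))
      (fun j => laurent_fps (xpow_fps (lam j) * log_in (g j)))].
Proof.
case: n b m => // n b m _ mI b0 basis F iota.
have charF : [pchar F] =i pred0 by move=> p; rewrite (fmorph_pchar iota) char0.
have bS e : solution P Q r (b e).
  apply/basis.1; exists (fun k => (k == e)%:R).
  rewrite (bigD1 e) //= eqxx rmorph1 mul1r big1 ?addr0 // => k /negPf->.
  by rewrite rmorph0 mul0r.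
have /choice[A0 A0E] : forall j, exists d : 'I_n.+1 -> fps K,
    dlog (b j) = \sum_k scalar_fps (d k) * b k.
  by move=> j; apply/basis.1/dlog_solution.
pose A : 'M[fps K]_n.+1 := \matrix_(j, k) A0 j k.
have [L [rs rsE]] :=
  puiseux charF (monic_map (fps_map iota) (char_poly_monic A)).
pose A' := map_mx (puiseux_scalar iota L) A.
have A'rs : char_poly A' = \prod_(z <- rs) ('X - z%:P).
  by rewrite -map_char_poly -rsE -map_poly_comp.
have [V [lam [Vu lamrs VP]]] := fps_generalized_eigenbasis A'rs.
pose e k := puiseux_ser iota L (b k).
have dlog_e j : dlog (e j) = \sum_k scalar_fps (A' j k) * e k.
  rewrite dlog_puiseux_ser A0E rmorph_sum; apply: eq_bigr => k _.
  by rewrite rmorphM /= puiseux_ser_scalar !mxE.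
(* The extension of scalars fixes the constant terms, which are monomials with coefficient 1. *)
have free : forall c : 'I_n.+1 -> fps F,
    \sum_k scalar_fps (c k) * e k = 0 -> forall k, c k = 0.
  apply: fps_free => c.
  under eq_bigr => k _ do rewrite /e /puiseux_ser /= div0n b0 map_logmon.
  exact: logmon_free.
pose f j := fps_comb e (row j V).
have fP j : iter n.+1 (dlog_sub (lam j)) (f j) = 0.
  rewrite (iter_dlog_sub_comb dlog_e) VP /fps_comb big1 // => k _.
  by rewrite mxE rmorph0 mul0r.
(* Otherwise [f j] would be zero, and by freeness so would row j of the invertible matrix V. *)
have lam0 j : lam j 0%N = 0.
  apply/eqP; apply: contraT => /iter_dlog_sub_inj/(_ (fP j))/free V0.
  have : row j (map_mx (@laurent_fps F) V) = 0.
    by apply/rowP => k; have := V0 k; rewrite !mxE => ->; rewrite rmorph0.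
  rewrite rowE => /(congr1 (mulmx^~ (invmx (map_mx (@laurent_fps F) V)))).
  rewrite mulmxK // mul0mx => /matrixP/(_ 0 j).
  by rewrite !mxE !eqxx => /eqP; rewrite oner_eq0.
have /choice[g gP] := fun j =>
  generalized_eigenvector_xpow charF (lam0 j) (fP j).
exists L.+1, lam, g; split=> // [j|]; first by have [] := gP j.
apply: (is_basis_change Vu) (puiseux_span_basis basis free) => j.
have [_ <-] := gP j; rewrite /f /fps_comb rmorph_sum; apply: eq_bigr => k _.
by rewrite rmorphM !mxE /= scalar_laurent_fps.
Qed.

(** * Integer shifts of the exponent, root multiplicities and the theorem *)

Section Shift.
Variables (K : comNzRingType) (P : {poly K}) (Q : nat -> {poly laurent K}).
Implicit Types (f : logser K) (m : int).

Lemma mul_xnK m f : mul_xn m (mul_xn (- m) f) = f.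
Proof.
apply: fpsP => n /=.
by rewrite scalerA lmonM subrr mulr1 lmon1 scale1r.
Qed.

Lemma mul_xn0 m : mul_xn m 0 = 0 :> logser K.
Proof. by apply: fpsP => n /=; rewrite scaler0. Qed.

Lemma solution_shift r m f :
  solution P Q (r + m%:~R) f <-> solution P Q r (mul_xn m f).
Proof.
have PQE : PQ P Q r (mul_xn m f) = mul_xn m (PQ P Q (r + m%:~R) f).
  by apply: (@PQ_morph _ P Q _ _ ( *:%R (lmon 1 m))) => q; rewrite /= dx_lmonZ.
rewrite /solution PQE; split=> [->|]; first exact: mul_xn0.
move/(congr1 (mul_xn (- m))); rewrite mul_xn0.
by rewrite -{2}[m]opprK mul_xnK.
Qed.

End Shift.

Section RootCount.
Variable K : fieldType.

(** Converts a factorization into powers of linear factors to a list of roots whose [count_mem] is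
    known in closed form. *)
Definition splits_with (P : {poly K}) (c : K -> nat) :=
  exists zs, P = \prod_(z <- zs) ('X - z%:P) /\ forall z, count_mem z zs = c z.

Lemma splits_with_prod I (r : seq I) (P_ : I -> {poly K}) (c_ : I -> K -> nat) :
    (forall i, splits_with (P_ i) (c_ i)) ->
  splits_with (\prod_(i <- r) P_ i) (fun z => \sum_(i <- r) c_ i z)%N.
Proof.
move=> H; elim: r => [|i r [zs [PE cE]]].
  by exists [::]; rewrite !big_nil; split=> // z; rewrite big_nil.
have [zi [PiE ciE]] := H i; exists (zi ++ zs).
rewrite big_cons big_cat -PE -PiE; split=> // z.
by rewrite big_cons count_cat ciE cE.
Qed.

Lemma splits_with_exp z0 n :
  splits_with (('X - z0%:P) ^+ n) (fun z => n * (z0 == z))%N.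
Proof.
exists (nseq n z0); split=> [|z]; last by rewrite count_nseq mulnC.
by rewrite big_nseq iter_mulr_1.
Qed.

Hypothesis char0 : [pchar K] =i pred0.

Lemma intr_eq0_char0 (j : int) : (j%:~R == 0 :> K) = (j == 0).
Proof.
case: j => n; first by rewrite -pmulrn ((pcharf0P K).1 char0).
by rewrite NegzE mulrNz oppr_eq0 -pmulrn ((pcharf0P K).1 char0).
Qed.

(** Only the class of s_i contributes, by non-congruence; within it only the index j, because
    integers embed in K in characteristic zero. *)
Lemma count_representative l (s : 'I_l -> K) (a : 'I_l -> seq nat) i (j : int) :
    (forall i i' : 'I_l, i != i' -> forall m : int, s i - s i' <> m%:~R) ->
  (\sum_(i' < l) \sum_(j' < size (a i'))
     nth 0 (a i') j' * ((s i' + j'%:R)%R == (s i + j%:~R)%R))%N =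
  if j is Posz m then nth 0%N (a i) m else 0%N.
Proof.
move=> nc; rewrite (bigD1 i) //= [X in (_ + X)%N]big1 ?addn0; last first.
  move=> i' ne; rewrite big1 // => j' _.
  case: eqP => [E|_]; last by rewrite muln0.
  case: (nc i' i ne (j - j'%:Z)); rewrite rmorphB /= -pmulrn.
  by apply/eqP; rewrite subr_eq addrAC eq_sym subr_eq eq_sym addrC -E addrC.
have E (j' : nat) : (s i + j'%:R == s i + j%:~R) = (j'%:Z == j).
  rewrite (inj_eq (addrI _)) -subr_eq0 pmulrn -rmorphB intr_eq0_char0.
  by rewrite subr_eq0.
under eq_bigr do rewrite E.
case: j E => [m|m] _; last by rewrite big1 // => j' _; rewrite muln0.
have [ltm|lem] := ltnP m (size (a i)).
  rewrite (bigD1 (Ordinal ltm)) //= eqxx muln1 big1 ?addn0 // => j'.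
  by rewrite -val_eqE eqz_nat /= => /negPf->; rewrite muln0.
rewrite nth_default // big1 // => j' _; rewrite eqz_nat.
by rewrite ltn_eqF ?muln0 // (leq_trans (ltn_ord j')).
Qed.

End RootCount.

Theorem theorem3p1 (K : fieldType) (char0 : [pchar K] =i pred0)
    (* P is a polynomial in x d/dx, see PQ *)
    (k : nat) (r_ : 'I_k -> K) (P : {poly K})
    (defP : P = \prod_(p < k) ('X - (r_ p)%:P))
    (Q : nat -> {poly (laurent K)})
    (l : nat) (s : 'I_l -> K)
    (s_noncongr : forall i j : 'I_l, i != j ->
       forall m : int, s i - s j <> m%:~R)
    (s_in_r : forall i : 'I_l, exists p : 'I_k, s i = r_ p)
    (r_from_s : forall p : 'I_k, exists (i : 'I_l) (m : nat),
       r_ p = s i + m%:R)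
    (* a_{i,j} is the j-th item of a i, and 0 if there is none *)
    (a : 'I_l -> seq nat)
    (factorP : P = \prod_(i < l) \prod_(j < size (a i))
       ('X - (s i + j%:R)%:P) ^+ nth 0%N (a i) j) :
  let k_ := fun i : 'I_l => (\sum_(j < size (a i)) nth 0%N (a i) j)%N in
  (forall r : K,
     (exists f : logser K, f <> 0 /\ solution P Q r f) <->
     (exists (i : 'I_l) (m : int), r - s i = m%:~R)) /\
  (* x^r f = x^(s i) (x^m f) when r = s i + m *)
  (forall (i : 'I_l) (m : int) (f : logser K),
     solution P Q (s i + m%:~R) f <-> solution P Q (s i) (mul_xn m f)) /\
  (forall i : 'I_l, exists b : 'I_(k_ i) -> logser K,
     is_basis (@scalar_fps K) (solution P Q (s i)) b) /\
  (forall (Kbar : closedFieldType) (iota : {rmorphism K -> Kbar}),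
     (forall z : Kbar, algebraicOver iota z) ->
     forall i : 'I_l,
     exists (L : nat) (lam : 'I_(k_ i) -> fps Kbar)
            (g : 'I_(k_ i) -> {poly (fps (laurent Kbar))}),
       (0 < L)%N /\
       (forall j, lam j 0%N = 0) /\
       (forall j, (size (g j) <= k_ i)%N) /\
       is_basis (@scalar_laurent Kbar)
         (span_image (@scalar_laurent Kbar) (puiseux_in iota L)
            (solution P Q (s i)))
         (fun j => laurent_fps (xpow_fps (lam j) * log_in (g j)))).
Proof.
move=> k_.
have [zs [PE countE]] : splits_with P
    (fun z => \sum_(i < l) \sum_(j < size (a i))
      nth 0 (a i) j * ((s i + j%:R)%R == z))%N.
  by rewrite factorP; do 2!apply: splits_with_prod => ?; apply: splits_with_exp.
have count_s i j : count_mem (s i + j%:~R) zs =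
    if j is Posz m then nth 0%N (a i) m else 0%N.
  by rewrite countE; apply: count_representative.
have basis i : exists (m : 'I_(k_ i) -> nat * nat) (b : 'I_(k_ i) -> logser K),
    [/\ injective m, (0 < k_ i)%N, forall e, b e 0%N = logmon K (m e)
      & is_basis (@scalar_fps K) (solution P Q (s i)) b].
  have [m [mI mE]] := enum_exponents (a i).
  have [b [_ b0 bP]] := solution_basis char0 Q (count_s i) mI mE.
  exists m, b; rewrite PE; split=> //.
  (* As a root of P, s_i has multiplicity a_{i,0} > 0, and this forces k_i > 0. *)
  have : s i \in zs.
    have [p sp] := s_in_r i; rewrite -root_prod_XsubC -PE defP sp.
    by rewrite (bigD1 p) //= rootM root_XsubC eqxx.
  rewrite -has_pred1 has_count -[s i]addr0 (count_s i 0) => /mE[e _].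
  exact: leq_ltn_trans (ltn_ord e).
split; [move=> r; split | split; [|split]].
(* The lowest coefficient in t of a nonzero solution is killed by P. Any x^j occurring in it makes r
   + j a root of P, hence equal to some s_i + j'. *)
- move=> [f [/eqP/fps_neq0[n fn fltn] fP]].
  have en : euler_op r zs (f n) = 0.
    have := congr1 (fun h : logser K => h n) fP.
    rewrite coef_PQ big_ord_recl subn0.
    rewrite big1 ?addr0 => [|i _]; first by rewrite /= PE.
    by rewrite fltn ?raddf0 //= /bump /=; have := ltn_ord i; lia.
  have [j xj] : exists j, xcoef j (f n) != 0.
    apply: contrapT => /forallNP x0; case/eqP: fn; apply: xcoefP => j.
    by rewrite xcoef0; apply/eqP/negPn/negP/x0.
  have := (euler_op_eq0 char0 r zs (f n)).1 en j.
  rewrite -size_poly_gt0 in xj; move/(leq_trans xj).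
  rewrite countE lt0n sum_nat_eq0 => /forallPn[i]; rewrite /= sum_nat_eq0.
  case/forallPn=> j'.
  have [E _|_] := s i + j'%:R =P r + j%:~R; last by rewrite muln0.
  exists i, (j'%:Z - j); rewrite rmorphB /= -pmulrn.
  by apply/eqP; rewrite subr_eq addrAC eq_sym subr_eq addrC E.
- move=> [i [m rE]]; have [m' [b [_ k0 b0 bP]]] := basis i.
  have {k0} e : 'I_(k_ i) := Ordinal k0.
  (* A basis element moved to the exponent r; its t^0 coefficient is a shifted monomial, hence
     nonzero. *)
  exists (mul_xn (- m) (b e)).
  have -> : r = s i + m%:~R by rewrite -rE addrC subrK.
  split; last first.
    apply/solution_shift; rewrite mul_xnK; apply/bP.1.
    exists (fun k => (k == e)%:R); rewrite (bigD1 e) //= eqxx rmorph1 mul1r.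
    by rewrite big1 ?addr0 // => k' /negPf->; rewrite rmorph0 mul0r.
  move/(congr1 (mul_xn m)); rewrite mul_xnK mul_xn0.
  move/(congr1 (fun h : logser K => (h 0%N)`_(m' e).2 (m' e).1)).
  rewrite b0 /logmon coefZ coefXn eqxx mulr1 coef0 /= eqxx => /eqP.
  by rewrite oner_eq0.
- by move=> i m f; apply: solution_shift.
- by move=> i; have [_ [b [_ _ _ bP]]] := basis i; exists b.
move=> Kbar iota _ i; have [m [b [mI k0 b0 bP]]] := basis i.
have [L [lam [g [? ? ? ?]]]] := puiseux_basis char0 k0 mI b0 bP iota.
by exists L, lam, g.
Qed.
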